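(* Let $(X,d,\alpha)$ be a computable metric space. Let $S$ be a semi-computable compact set in this space and suppose $x\in S$ is a point which has a neighborhood in $S$ homeomorphic to $\mathbb R^n$ for some $n\in\mathbb N$. Then there exists a neighborhood of $x$ in $S$ which is computable up to $S$.
   Context: A computable metric space is a triple $(X,d,\alpha)$ where $(X,d)$ is a metric space and $\alpha=(\alpha_i)_{i\in\mathbb N}$ is a sequence with dense range in $(X,d)$ such that $(i,j)\mapsto d(\alpha_i,\alpha_j)$ is a computable function $\mathbb N^2\to\mathbb R$ (a function $g:\mathbb N^k\to\mathbb R$ is computable if there is a computable $G:\mathbb N^{k+1}\to\mathbb Q$ with $|g(x)-G(x,i)|<2^{-i}$ for all $x,i$). Fix a computable $q:\mathbb N\to\mathbb Q$ whose image is the set of positive rationals and computable $\tau_1,\tau_2:\mathbb N\to\mathbb N$ with $\{(\tau_1(i),\tau_2(i)):i\in\mathbb N\}=\mathbb N^2$; let $\lambda_i=\alpha_{\tau_1(i)}$, $\rho_i=q_{\tau_2(i)}$, $I_i=B(\lambda_i,\rho_i)$ (open ball). Fix computable $\sigma:\mathbb N^2\to\mathbb N$, $\eta:\mathbb N\to\mathbb N$ such that $\{(\sigma(j,0),\dots,\sigma(j,\eta(j))):j\in\mathbb N\}$ is the set of all nonempty finite sequences in $\mathbb N$; let $[j]=\{\sigma(j,i):0\le i\le\eta(j)\}$, $J_j=\bigcup_{i\in[j]}I_i$ and $\Lambda_j=\{\alpha_i:i\in[j]\}$. A set $K\subseteq X$ is a semi-computable compact set if $K$ is compact in $(X,d)$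 and $\{j\in\mathbb N: K\subseteq J_j\}$ is computably enumerable. For $A,B\subseteq X$ and $\varepsilon>0$ write $A\prec_\varepsilon B$ if for each $a\in A$ there is $b\in B$ with $d(a,b)<\varepsilon$. For $A\subseteq B\subseteq X$, $A$ is computable up to $B$ if there is a computable $f:\mathbb N\to\mathbb N$ with $A\prec_{2^{-k}}\Lambda_{f(k)}$ and $\Lambda_{f(k)}\prec_{2^{-k}}B$ for all $k$. A neighborhood of $x$ in $S$ is a subset of $S$ containing $x$ in its interior relative to $S$. *)

(* Defs.v *)
From Stdlib Require Import Reals Lra Lia List.
Import ListNotations.
Open Scope R_scope.

Inductive rf : Type :=
| RZero : rf
| RSucc : rf
| RProj : nat -> rf
| RComp : rf -> list rf -> rf
| RRec : rf -> rf -> rf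
| RMu : rf -> rf.

Inductive reval : rf -> list nat -> nat -> Prop :=
| ev_zero xs : reval RZero xs 0
| ev_succ x xs : reval RSucc (x :: xs) (S x)
| ev_proj i xs : reval (RProj i) xs (nth i xs 0%nat)
| ev_comp f gs xs ys y :
    Forall2 (fun g y => reval g xs y) gs ys -> reval f ys y -> reval (RComp f gs) xs y
| ev_rec0 f g xs y : reval f xs y -> reval (RRec f g) (0%nat :: xs) y
| ev_recS f g n xs z y :
    reval (RRec f g) (n :: xs) z -> reval g (n :: z :: xs) y -> reval (RRec f g) (S n :: xs) y
| ev_mu f xs n :
    reval f (n :: xs) 0%nat ->
    (forall m, (m < n)%nat -> exists k, reval f (m :: xs) (S k)) ->
    reval (RMu f) xs n.

Definition computable1 (f : nat -> nat) : Prop :=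
  exists p, forall n, reval p [n] (f n).
Definition computable2 (f : nat -> nat -> nat) : Prop :=
  exists p, forall n m, reval p [n; m] (f n m).
Definition computable3 (f : nat -> nat -> nat -> nat) : Prop :=
  exists p, forall n m k, reval p [n; m; k] (f n m k).

Definition c_e (A : nat -> Prop) : Prop :=
  exists p, forall n, A n <-> exists y, reval p [n] y.

Definition qval (s a b : nat) : R := (-1) ^ s * INR a / INR (S b).

Definition is_rational (r : R) : Prop := exists s a b, r = qval s a b.

Definition computable_Q1 (q : nat -> R) : Prop :=
  exists s a b, computable1 s /\ computable1 a /\ computable1 b /\
    forall n, q n = qval (s n) (a n) (b n).

Definition computable_R2 (g : nat -> nat -> R) : Prop :=
  exists s a b, computable3 s /\ computable3 a /\ computable3 b /\
    forall i j k, Rabs (g i j - qval (s i j k) (a i j k) (b i j k)) < / 2 ^ k.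

Definition is_metric {X : Type} (d : X -> X -> R) : Prop :=
  (forall x y, 0 <= d x y) /\
  (forall x y, d x y = 0 <-> x = y) /\
  (forall x y, d x y = d y x) /\
  (forall x y z, d x z <= d x y + d y z).

Definition dense_seq {X : Type} (d : X -> X -> R) (alpha : nat -> X) : Prop :=
  forall x eps, 0 < eps -> exists i, d x (alpha i) < eps.

Definition computable_metric_space {X : Type} (d : X -> X -> R) (alpha : nat -> X) : Prop :=
  is_metric d /\ dense_seq d alpha /\ computable_R2 (fun i j => d (alpha i) (alpha j)).

Definition ball {X : Type} (d : X -> X -> R) (c : X) (r : R) : X -> Prop :=
  fun y => d c y < r.

Definition is_open {X : Type} (d : X -> X -> R) (U : X -> Prop) : Prop :=
  forall x, U x -> exists r, 0 < r /\ forall y, d x y < r -> U y.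

Definition compact {X : Type} (d : X -> X -> R) (K : X -> Prop) : Prop :=
  forall (I : Type) (U : I -> X -> Prop),
    (forall i, is_open d (U i)) ->
    (forall x, K x -> exists i, U i x) ->
    exists l : list I, forall x, K x -> exists i, In i l /\ U i x.

Definition fixed_enumerations (q : nat -> R) (tau1 tau2 : nat -> nat)
  (sigma : nat -> nat -> nat) (eta : nat -> nat) : Prop :=
  computable_Q1 q /\
  (forall n, 0 < q n) /\
  (forall r, 0 < r -> is_rational r -> exists n, q n = r) /\
  computable1 tau1 /\ computable1 tau2 /\
  (forall a b, exists i, tau1 i = a /\ tau2 i = b) /\
  computable2 sigma /\ computable1 eta /\
  (forall l : list nat, l <> [] ->
     exists j, S (eta j) = length l /\ forall i, (i < length l)%nat -> sigma j i = nth i l 0%nat).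

Section Derived.
Context {X : Type} (d : X -> X -> R) (alpha : nat -> X) (q : nat -> R)
  (tau1 tau2 : nat -> nat) (sigma : nat -> nat -> nat) (eta : nat -> nat).

Definition lam (i : nat) : X := alpha (tau1 i).
Definition rho (i : nat) : R := q (tau2 i).
Definition Iball (i : nat) : X -> Prop := ball d (lam i) (rho i).
Definition in_code (j i : nat) : Prop := exists k, (k <= eta j)%nat /\ sigma j k = i.
Definition Jset (j : nat) : X -> Prop := fun x => exists i, in_code j i /\ Iball i x.
Definition Lambda (j : nat) : X -> Prop := fun x => exists i, in_code j i /\ x = alpha i.

Definition semicomputable_compact (K : X -> Prop) : Prop :=
  compact d K /\ c_e (fun j => forall x, K x -> Jset j x).

Definition computable_up_to (A B : X -> Prop) : Prop :=
  exists f, computable1 f /\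
    forall k : nat,
      (forall a, A a -> exists b, Lambda (f k) b /\ d a b < / 2 ^ k) /\
      (forall a, Lambda (f k) a -> exists b, B b /\ d a b < / 2 ^ k).
End Derived.

Definition nbhd_in {X : Type} (d : X -> X -> R) (S N : X -> Prop) (x : X) : Prop :=
  (forall y, N y -> S y) /\ N x /\
  exists r, 0 < r /\ forall y, S y -> d x y < r -> N y.

Fixpoint sumR (n : nat) (f : nat -> R) : R :=
  match n with O => 0 | S m => sumR m f + f m end.

(* R^n realised as sequences vanishing from index n on *)
Definition Rn (n : nat) (v : nat -> R) : Prop := forall i, (n <= i)%nat -> v i = 0.
Definition dist_n (n : nat) (v w : nat -> R) : R := sqrt (sumR n (fun i => (v i - w i) ^ 2)).

Definition continuous_on {X Y : Type} (dX : X -> X -> R) (dY : Y -> Y -> R)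
  (A : X -> Prop) (f : X -> Y) : Prop :=
  forall x, A x -> forall eps, 0 < eps -> exists delta, 0 < delta /\
    forall y, A y -> dX x y < delta -> dY (f x) (f y) < eps.

Definition homeomorphic_Rn {X : Type} (d : X -> X -> R) (N : X -> Prop) (n : nat) : Prop :=
  exists (f : X -> (nat -> R)) (g : (nat -> R) -> X),
    (forall x, N x -> Rn n (f x)) /\
    (forall v, Rn n v -> N (g v)) /\
    (forall x, N x -> g (f x) = x) /\
    (forall v, Rn n v -> f (g v) = v) /\
    continuous_on d (dist_n n) N f /\
    continuous_on (dist_n n) d (Rn n) g.

(* Main.v *)
(* Scale a chart around [x] so that the cubes [-r, r]^n with r <= 1 are closed in [S]. To certify
   that a small rational ball [e] meets [S], exhibit rational open sets [U_i, V_i] (i < n) with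
   [U_i] formally disjoint from [V_i], [U_i] (resp. [V_i]) formally disjoint from a fixed
   neighbourhood of the upper (resp. lower) i-th face of the cube E = [-3/4, 3/4]^n, such that
   [e], the [U_i], the [V_i] and a fixed open set missing [E] cover [S]. Such data can be
   searched for, since [S] is semi-computable. They are conclusive: the complements of the
   [U_i \/ V_i] in [E] separate opposite faces, hence have a common point (Eilenberg-Otto), which
   only [e] can cover. And they exist for every ball around a point [y] of [-1/2, 1/2]^n: take
   for [U_i] and [V_i] neighbourhoods of {h_i <= h_i(y) - s} and {h_i >= h_i(y) + s}. Finally, to
   approximate [-1/4, 1/4]^n, search for certified balls covering [S] together with a fixed
   open set that contains the complement of [-1/2, 1/2]^n and misses [-1/4, 1/4]^n.

   The Eilenberg-Otto theorem is discretised on a grid. For labels l_i with l_i = 0 on the lower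
   and l_i = 1 on the upper i-th face, the cochain dl_1 cup ... cup dl_n is the coboundary of
   l_1 (dl_2 cup ... cup dl_n), so by Stokes and induction its sum over all cells is 1
   modulo 2; hence on some cell no l_i is constant. *)

From Stdlib Require Import Reals Lra Lia List Wf_nat Compare_dec Classical ClassicalEpsilon
  FunctionalExtensionality.
Require Import Defs.
Import ListNotations.

(** * A cubical Sperner lemma modulo 2 *)

Section Kuhn.
Local Open Scope nat_scope.

Definition upd (z : nat -> nat) (i t : nat) : nat -> nat :=
  fun j => if Nat.eq_dec j i then t else z j.
Definition inc (z : nat -> nat) (i : nat) : nat -> nat := upd z i (S (z i)).

(** [bool] with [xorb] and [andb] is the field with two elements, in which all cochains take their
    values. *)
Fixpoint xsum {A : Type} (l : list A) (f : A -> bool) : bool :=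
  match l with [] => false | a :: l' => xorb (f a) (xsum l' f) end.

Notation without i D := (remove Nat.eq_dec i D).

Lemma upd_comm z i j s t : i <> j -> upd (upd z i s) j t = upd (upd z j t) i s.
Proof.
  intros H; apply functional_extensionality; intros k; unfold upd.
  destruct (Nat.eq_dec k i), (Nat.eq_dec k j); congruence.
Qed.

Lemma upd_upd z i s t : upd (upd z i s) i t = upd z i t.
Proof.
  apply functional_extensionality; intros k; unfold upd.
  destruct (Nat.eq_dec k i); congruence.
Qed.

Lemma upd_same z i t : upd z i t i = t.
Proof. unfold upd; destruct (Nat.eq_dec i i); congruence. Qed.

Lemma upd_other z i j t : j <> i -> upd z i t j = z j.
Proof. unfold upd; destruct (Nat.eq_dec j i); congruence. Qed.

Lemma inc_comm z i j : inc (inc z i) j = inc (inc z j) i.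
Proof.
  destruct (Nat.eq_dec i j) as [-> | H]; [reflexivity |].
  unfold inc; rewrite !upd_other by congruence; apply upd_comm; assumption.
Qed.

Lemma xsum_ext {A} (l : list A) f g :
  (forall a, In a l -> f a = g a) -> xsum l f = xsum l g.
Proof.
  induction l as [|a l IH]; intros H; simpl; [reflexivity |].
  rewrite H, IH; [reflexivity | |]; firstorder.
Qed.

Lemma xsum_false {A} (l : list A) f : (forall a, In a l -> f a = false) -> xsum l f = false.
Proof.
  induction l as [|a l IH]; intros H; simpl; [reflexivity |].
  rewrite H, IH; [reflexivity | |]; firstorder.
Qed.

Lemma xsum_xorb {A} (l : list A) f g :
  xsum l (fun a => xorb (f a) (g a)) = xorb (xsum l f) (xsum l g).
Proof.
  induction l as [|a l IH]; simpl; [reflexivity |]; rewrite IH.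
  destruct (f a), (g a), (xsum l f), (xsum l g); reflexivity.
Qed.

Lemma xsum_true {A} (l : list A) f : xsum l f = true -> exists a, In a l /\ f a = true.
Proof.
  intros H; apply NNPP; intros N.
  rewrite xsum_false in H; [discriminate |].
  intros a Ha; destruct (f a) eqn:E; [exfalso; eauto | reflexivity].
Qed.

Lemma xsum_andb {A} (l : list A) b f : xsum l (fun a => b && f a)%bool = (b && xsum l f)%bool.
Proof. induction l as [|a l IH]; simpl; [| rewrite IH]; destruct b; reflexivity. Qed.

(** Every unordered pair of distinct directions contributes twice, so the sum cancels modulo 2. *)
Lemma xsum_symmetric (D : list nat) (F : nat -> nat -> bool) :
  NoDup D -> (forall i j, F i j = F j i) ->
  xsum D (fun i => xsum (without i D) (F i)) = false.
Proof.
  intros HD HF; induction HD as [|a D Ha HD IH]; [reflexivity |].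
  cbn [xsum]; rewrite remove_cons, notin_remove by assumption.
  rewrite (xsum_ext D (fun i => xsum (without i (a :: D)) (F i)) (fun i => xorb (F a i) (xsum (without i D) (F i)))).
  - rewrite xsum_xorb, IH; destruct (xsum D (F a)); reflexivity.
  - intros i Hi; simpl; destruct (Nat.eq_dec i a) as [-> | Hne]; [contradiction |].
    simpl; rewrite HF; reflexivity.
Qed.

Definition cochain := (nat -> nat) -> list nat -> bool.

(** The cubical coboundary modulo 2: a free direction [i] gives two opposite faces of the cube, at
    [inc z i] and at [z]. *)
Definition cobd (w : cochain) : cochain := fun z D =>
  xsum D (fun i => xorb (w (inc z i) (without i D)) (w z (without i D))).

(* [cup [l_1; ...; l_k]] is the mod 2 cubical cup product of the coboundaries of the
   0-cochains [l_j]; a pair [(z, D)] stands for the cube at [z] with free directions [D]. *)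
Fixpoint cup (L : list ((nat -> nat) -> bool)) : cochain :=
  match L with
  | [] => fun _ _ => true
  | l :: L' => fun z D =>
      xsum D (fun i => xorb (l (inc z i)) (l z) && cup L' (inc z i) (without i D))%bool
  end.

Lemma NoDup_without i D : NoDup D -> NoDup (without i D).
Proof. intros; rewrite <- remove_alt; apply NoDup_filter; assumption. Qed.

Lemma cobd_cobd w z D : NoDup D -> cobd (cobd w) z D = false.
Proof.
  intros HD; unfold cobd.
  erewrite xsum_ext; [| intros i _; symmetry; apply xsum_xorb].
  apply (xsum_symmetric D (fun i j =>
    let E := without j (without i D) in
    xorb (xorb (w (inc (inc z i) j) E) (w (inc z i) E)) (xorb (w (inc z j) E) (w z E))));
    [assumption |].
  intros i j; simpl; rewrite (remove_remove_comm Nat.eq_dec D j i), (inc_comm z j i).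
  destruct (w (inc (inc z i) j) _), (w (inc z i) _), (w (inc z j) _), (w z _); reflexivity.
Qed.

(* Leibniz rule; the term [l * cobd (cup L)] vanishes. *)
Lemma cup_cobd l L z D : NoDup D ->
  cup (l :: L) z D = cobd (fun z D => l z && cup L z D)%bool z D.
Proof.
  assert (Leibniz : forall l L z D, cobd (cup L) z D = false ->
    cup (l :: L) z D = cobd (fun z D => l z && cup L z D)%bool z D).
  { clear; intros l L z D H; unfold cobd in H |- *; cbn [cup].
    transitivity (xorb (xsum D (fun i => xorb (l (inc z i)) (l z) && cup L (inc z i) (without i D))%bool)
      (l z && xsum D (fun i => xorb (cup L (inc z i) (without i D)) (cup L z (without i D))))%bool).
    - rewrite H, Bool.andb_false_r, Bool.xorb_false_r; reflexivity.
    - rewrite <- xsum_andb, <- xsum_xorb; apply xsum_ext; intros i _.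
      destruct (l z), (l (inc z i)), (cup L (inc z i) _), (cup L z _); reflexivity. }
  (* Closedness by induction: on the faces the Leibniz rule turns [cup (l :: L)] into a coboundary,
     and [cobd_cobd] kills the coboundary of that. *)
  assert (Closed : forall L z D, NoDup D -> cobd (cup L) z D = false).
  { clear - Leibniz; induction L as [|l L IH]; intros z D HD.
    - apply xsum_false; reflexivity.
    - rewrite <- (cobd_cobd (fun z D => l z && cup L z D)%bool z D HD).
      apply xsum_ext; intros i Hi.
      rewrite !Leibniz by (apply IH, NoDup_without; assumption); reflexivity. }
  intros HD; apply Leibniz, Closed, HD.
Qed.

(** Since [i] is not a free direction, the hyperplane through [z] on which coordinate [i] is fixed
    is never left; the factor belonging to [l] is a difference of two equal values. *)
Lemma cup_constant L z D i l b : In l L -> ~ In i D ->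
  (forall z', z' i = z i -> l z' = b) -> cup L z D = false.
Proof.
  revert z D; induction L as [|l' L IH]; intros z D Hl Hi Hc; [contradiction |].
  cbn [cup]; apply xsum_false; intros j Hj.
  assert (inc z j i = z i) as Hji by (apply upd_other; congruence).
  destruct Hl as [-> | Hl].
  - rewrite !Hc by (assumption || reflexivity); destruct b; reflexivity.
  - rewrite IH; [apply Bool.andb_false_r | assumption | |].
    + intros H; apply in_remove in H; tauto.
    + rewrite Hji; assumption.
Qed.

(** A nonzero product comes from a path of unit steps in distinct directions, one step per label,
    along which that label changes. *)
Lemma cup_nonconstant L z D l : cup L z D = true -> In l L ->
  exists z1 z2, (forall i, z i <= z1 i <= S (z i)) /\ (forall i, z i <= z2 i <= S (z i)) /\
    l z1 = false /\ l z2 = true.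
Proof.
  intros HT Hl.
  (* Strengthened for the induction: only coordinates in [D] may move. A direction already used has
     left [D], so no coordinate exceeds [S (z i)]. *)
  assert (H : exists z1 z2,
    (forall i, z i <= z1 i /\ (z1 i <= z i \/ In i D /\ z1 i <= S (z i))) /\
    (forall i, z i <= z2 i /\ (z2 i <= z i \/ In i D /\ z2 i <= S (z i))) /\ l z1 <> l z2).
  { revert z D HT; induction L as [|l' L IH]; intros z D HT; [contradiction |].
    cbn [cup] in HT; apply xsum_true in HT as (j & Hj & HT).
    apply andb_prop in HT as [HT1 HT2].
    destruct Hl as [-> | Hl].
    - exists (inc z j), z; split; [| split].
      + intros i; unfold inc, upd; destruct (Nat.eq_dec i j) as [-> |]; [split; [lia | right; split; [assumption | lia]] | lia].
      + intros i; lia.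
      + destruct (l (inc z j)), (l z); discriminate.
    - destruct (IH Hl _ _ HT2) as (z1 & z2 & H1 & H2 & Hne).
      assert (Q : forall z', (forall i, inc z j i <= z' i /\
          (z' i <= inc z j i \/ In i (without j D) /\ z' i <= S (inc z j i))) ->
        forall i, z i <= z' i /\ (z' i <= z i \/ In i D /\ z' i <= S (z i))).
      { intros z' H i; specialize (H i); unfold inc, upd in H.
        destruct (Nat.eq_dec i j) as [-> | Hij].
        - destruct H as [Ha [Hb | [Hb _]]]; [split; [lia | right; split; [assumption | lia]] |].
          apply remove_In in Hb; contradiction.
        - destruct H as [Ha [Hb | [Hb Hc]]]; [lia |].
          apply in_remove in Hb; tauto. }
      exists z1, z2; split; [| split]; auto. }
  destruct H as (z1 & z2 & H1 & H2 & Hne).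
  destruct (l z1) eqn:E1, (l z2) eqn:E2; try congruence.
  - exists z2, z1; repeat split; auto; try apply H1; try apply H2; specialize (H1 i); specialize (H2 i); lia.
  - exists z1, z2; repeat split; auto; try apply H1; try apply H2; specialize (H1 i); specialize (H2 i); lia.
Qed.

(** * Sums modulo 2 over the cells of a grid with [m] cells in each direction *)

Variable m : nat.

Fixpoint box (D : list nat) (F : (nat -> nat) -> bool) (z : nat -> nat) : bool :=
  match D with
  | [] => F z
  | i :: D' => xsum (seq 0 m) (fun t => box D' F (upd z i t))
  end.

Lemma box_ext D F G z : (forall z, F z = G z) -> box D F z = box D G z.
Proof. intros H; replace G with F; [reflexivity | apply functional_extensionality, H]. Qed.

Lemma box_false D z : box D (fun _ => false) z = false.
Proof.
  revert z; induction D as [|i D IH]; intros z; simpl; [reflexivity |].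
  apply xsum_false; auto.
Qed.

Lemma box_xorb D F G z : box D (fun z => xorb (F z) (G z)) z = xorb (box D F z) (box D G z).
Proof.
  revert z; induction D as [|i D IH]; intros z; simpl; [reflexivity |].
  rewrite <- xsum_xorb; apply xsum_ext; auto.
Qed.

Lemma box_xsum {A} D (l : list A) F z :
  box D (fun z => xsum l (fun a => F a z)) z = xsum l (fun a => box D (F a) z).
Proof.
  induction l as [|a l IH]; simpl; [apply box_false |].
  rewrite box_xorb, IH; reflexivity.
Qed.

Lemma box_upd D F z i t : ~ In i D -> box D F (upd z i t) = box D (fun z => F (upd z i t)) z.
Proof.
  revert z; induction D as [|j D IH]; intros z H; simpl; [reflexivity |].
  apply xsum_ext; intros s _; simpl in H.
  rewrite upd_comm by (intros ->; tauto); apply IH; tauto.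
Qed.

(** Fubini: the summation in direction [i] is moved innermost, where a coboundary telescopes. *)
Lemma box_pull D F z i : NoDup D -> In i D ->
  box D F z = box (without i D) (fun z => xsum (seq 0 m) (fun t => F (upd z i t))) z.
Proof.
  intros HD; revert z; induction HD as [|j D Hj HD IH]; intros z Hi; [contradiction |].
  destruct (Nat.eq_dec i j) as [-> | Hij].
  - rewrite remove_cons, notin_remove by assumption; simpl; rewrite box_xsum.
    apply xsum_ext; intros t _; apply box_upd; assumption.
  - simpl; destruct (Nat.eq_dec i j); [contradiction |]; simpl.
    apply xsum_ext; intros t _; apply IH; destruct Hi; congruence.
Qed.

Lemma box_true D F z : box D F z = true ->
  exists z', F z' = true /\ (forall i, In i D -> z' i < m) /\ (forall i, ~ In i D -> z' i = z i).
Proof.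
  revert z; induction D as [|i D IH]; intros z H; simpl in *.
  - exists z; firstorder.
  - apply xsum_true in H as (t & Ht & H); apply in_seq in Ht.
    destruct (IH _ H) as (z' & HF & Hlt & Heq).
    exists z'; split; [assumption | split].
    + intros j [<- | Hj]; [| auto].
      destruct (in_dec Nat.eq_dec i D); [auto |].
      rewrite Heq, upd_same by assumption; lia.
    + intros j Hj; rewrite Heq, upd_other; intuition.
Qed.

Lemma xsum_telescope (f : nat -> bool) k :
  xsum (seq 0 k) (fun t => xorb (f (S t)) (f t)) = xorb (f k) (f 0).
Proof.
  induction k as [|k IH]; [simpl; destruct (f 0); reflexivity |].
  assert (Happ : forall l g, xsum (l ++ [k]) g = xorb (xsum l g) (g k)).
  { clear; intros l g; induction l as [|a l IH]; simpl.
    - destruct (g k); reflexivity.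
    - rewrite IH; destruct (g a), (xsum l g), (g k); reflexivity. }
  rewrite seq_S; simpl; rewrite Happ, IH.
  destruct (f 0), (f k), (f (S k)); reflexivity.
Qed.

(** Stokes: in each direction the inner sum telescopes, leaving the two opposite faces of the
    grid. *)
Lemma box_cobd D w z : NoDup D ->
  box D (fun z => cobd w z D) z = xsum D (fun i => box (without i D)
    (fun z => xorb (w (upd z i m) (without i D)) (w (upd z i 0) (without i D))) z).
Proof.
  intros HD; unfold cobd; rewrite box_xsum; apply xsum_ext; intros i Hi.
  rewrite (box_pull D _ z i HD Hi); apply box_ext; intros z'.
  rewrite <- (xsum_telescope (fun t => w (upd z' i t) (without i D))).
  apply xsum_ext; intros t _; unfold inc; rewrite upd_upd, upd_same; reflexivity.
Qed.

Variable l : nat -> (nat -> nat) -> bool.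

(** Induction on the dimension: by Leibniz and Stokes the sum is a boundary term, to which a single
    face contributes. *)
Lemma box_cup D z : NoDup D ->
  (forall i z, In i D -> z i = 0 -> l i z = false) ->
  (forall i z, In i D -> z i = m -> l i z = true) ->
  box D (fun z => cup (map l D) z D) z = true.
Proof.
  intros HD; revert z; induction HD as [|a D Ha HD IH]; intros z H0 H1; [reflexivity |].
  assert (HaD : NoDup (a :: D)) by (constructor; assumption).
  rewrite (box_ext _ _ (fun z => cobd (fun z E => l a z && cup (map l D) z E)%bool z (a :: D)))
    by (intros z'; apply cup_cobd; assumption).
  rewrite box_cobd by assumption; cbn [xsum].
  rewrite remove_cons, notin_remove by assumption.
  rewrite xsum_false.
  (* The faces in direction [a]: [l a] is 0 on the lower one and 1 on the upper one, where the sum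
     of lower dimension remains. *)
  - rewrite (box_ext D _ (fun z => cup (map l D) (upd z a m) D)).
    + rewrite <- (box_upd D (fun z => cup (map l D) z D)) by assumption.
      rewrite IH; [reflexivity | |]; firstorder.
    + intros z'; rewrite (H1 a), (H0 a) by (simpl; auto using upd_same).
      simpl; apply Bool.xorb_false_r.
  (* On a face in another direction [i] the label [l i] is constant, so the product over [D]
     vanishes there. *)
  - intros i Hi; rewrite <- (box_false (without i (a :: D)) z); apply box_ext; intros z'.
    assert (HiD : ~ In i (without i (a :: D))) by (apply remove_In).
    rewrite (cup_constant (map l D) (upd z' i m) _ i (l i) true),
      (cup_constant (map l D) (upd z' i 0) _ i (l i) false); auto using in_map.
    + rewrite !Bool.andb_false_r; reflexivity.
    + intros z'' E; apply H0; [right; assumption | rewrite E; apply upd_same].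
    + intros z'' E; apply H1; [right; assumption | rewrite E; apply upd_same].
Qed.

(** An odd total forces a cell with nonzero cup product; [cup_nonconstant] then provides the two
    vertices for each label. *)
Theorem kuhn (n : nat) :
  (forall i z, i < n -> z i = 0 -> l i z = false) ->
  (forall i z, i < n -> z i = m -> l i z = true) ->
  exists z, (forall i, i < n -> z i < m) /\ forall i, i < n -> exists z1 z2,
    (forall j, z j <= z1 j <= S (z j)) /\ (forall j, z j <= z2 j <= S (z j)) /\
    l i z1 = false /\ l i z2 = true.
Proof.
  intros H0 H1.
  destruct (box_true (seq 0 n) (fun z => cup (map l (seq 0 n)) z (seq 0 n)) (fun _ => 0))
    as (z & Hz & Hlt & _).
  - apply box_cup; [apply seq_NoDup | |]; intros i z Hi; apply in_seq in Hi; [apply H0 | apply H1]; lia.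
  - exists z; split; intros i Hi.
    + apply Hlt, in_seq; lia.
    + apply (cup_nonconstant _ _ _ (l i) Hz), in_map, in_seq; lia.
Qed.
End Kuhn.

(** * Partitions of a cube *)

Section Topology.
Context {X : Type} (d : X -> X -> R).
Hypothesis metric_d : is_metric d.

Lemma d_refl x : d x x = 0.
Proof. apply metric_d; reflexivity. Qed.

Lemma d_sym x y : d x y = d y x.
Proof. apply metric_d. Qed.

Lemma d_triangle x y z : d x z <= d x y + d y z.
Proof. apply metric_d. Qed.

Lemma uniform_radius {A : Type} (l : list A) (P : A -> R -> Prop) :
  (forall a r r', 0 < r' <= r -> P a r -> P a r') ->
  (forall a, In a l -> exists r, 0 < r /\ P a r) ->
  exists r, 0 < r /\ forall a, In a l -> P a r.
Proof.
  intros Hanti; induction l as [|a l IH]; intros H.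
  - exists 1; split; [lra | intros a []].
  - destruct IH as (r1 & Hr1 & H1); [intros; apply H; right; assumption |].
    destruct (H a) as (r2 & Hr2 & H2); [left; reflexivity |].
    assert (0 < Rmin r1 r2) by (apply Rmin_glb_lt; assumption).
    pose proof (Rmin_l r1 r2); pose proof (Rmin_r r1 r2).
    exists (Rmin r1 r2); split; [assumption |].
    intros b [<- | Hb]; [apply (Hanti a r2) | apply (Hanti b r1)]; auto.
Qed.

Lemma uniform_radius_lt (n : nat) (P : nat -> R -> Prop) :
  (forall i r r', 0 < r' <= r -> P i r -> P i r') ->
  (forall i, (i < n)%nat -> exists r, 0 < r /\ P i r) ->
  exists r, 0 < r /\ forall i, (i < n)%nat -> P i r.
Proof.
  intros Hanti H; destruct (uniform_radius (seq 0 n) P Hanti) as (r & Hr & HP).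
  - intros i Hi; apply in_seq in Hi; apply H; lia.
  - exists r; split; [assumption |]; intros i Hi; apply HP, in_seq; lia.
Qed.

(** Relative closedness, tested only at points of [M]; as [K] lies in [M], balls of the whole space
    give the same notion. *)
Definition closed_in (M K : X -> Prop) : Prop :=
  (forall y, K y -> M y) /\
  forall y, M y -> ~ K y -> exists r, 0 < r /\ forall z, d y z < r -> ~ K z.

Lemma closed_in_ext M K L : (forall y, K y <-> L y) -> closed_in M K -> closed_in M L.
Proof.
  intros HKL [HKM HK]; split; [intros y Hy; apply HKM, HKL, Hy |].
  intros y Hy HLy; destruct (HK y Hy) as (r & Hr & H); [rewrite HKL; assumption |].
  exists r; split; [assumption |]; intros z Hz; rewrite <- HKL; auto.
Qed.

Lemma is_open_ball c r : is_open d (fun y => d c y < r).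
Proof.
  intros y Hy; exists (r - d c y); split; [lra |].
  intros z Hz; pose proof (d_triangle c y z); lra.
Qed.

Lemma compact_closed_in M K : compact d M -> closed_in M K -> compact d K.
Proof.
  intros HM [HKM HK] I U HU Hcov.
  (* The index [None] carries the set of points having a ball disjoint from [K], which completes a
     cover of [K] to one of [M]. *)
  destruct (HM (option I) (fun o => match o with
      | Some i => U i
      | None => fun y => exists r, 0 < r /\ forall z, d y z < r -> ~ K z end)) as [l Hl].
  - intros [i |]; [apply HU |].
    intros y (r & Hr & Hy); exists r; split; [assumption |]; intros z Hz.
    exists (r - d y z); split; [lra |]; intros t Ht; apply Hy.
    pose proof (d_triangle y z t); lra.
  - intros y Hy; destruct (classic (K y)) as [Hk | Hk].
    + destruct (Hcov y Hk) as [i Hi]; exists (Some i); assumption.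
    + exists None; apply HK; assumption.
  - exists (flat_map (fun o => match o with Some i => [i] | None => [] end) l).
    intros y Hy; destruct (Hl y (HKM y Hy)) as ([i |] & Hi & Hu).
    + exists i; split; [| assumption].
      apply in_flat_map; exists (Some i); split; [assumption | left; reflexivity].
    + destruct Hu as (r & Hr & Hu); exfalso; apply (Hu y); [rewrite d_refl; lra | assumption].
Qed.

Lemma compact_separated M K L : compact d K -> (forall y, K y -> M y) -> closed_in M L ->
  (forall y, K y -> ~ L y) -> exists r, 0 < r /\ forall a b, K a -> L b -> r <= d a b.
Proof.
  intros HK HKM [_ HL] Hdis.
  (* [K] is covered by balls such that the concentric balls of twice the radius miss [L]; the least
     of the finitely many radii is then a lower bound for the distance. *)
  destruct (HK {p : X * R | 0 < snd p /\ forall z, d (fst p) z < 2 * snd p -> ~ L z}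
    (fun p z => d (fst (proj1_sig p)) z < snd (proj1_sig p))) as [l Hl].
  - intros p; apply is_open_ball.
  - intros y Hy; destruct (HL y (HKM y Hy) (Hdis y Hy)) as (r & Hr & Hz).
    assert (Hp : 0 < snd (y, r / 2) /\
      forall z, d (fst (y, r / 2)) z < 2 * snd (y, r / 2) -> ~ L z).
    { simpl; split; [lra |]; intros z Hlt; apply Hz; lra. }
    exists (exist _ (y, r / 2) Hp); simpl; rewrite d_refl; lra.
  - destruct (uniform_radius l (fun p r => r <= snd (proj1_sig p))) as (r & Hr & Hmin).
    + intros p s s' Hs; lra.
    + intros p _; exists (snd (proj1_sig p)); split; [apply (proj2_sig p) | lra].
    + exists r; split; [assumption |]; intros a b Ha Hb.
      destruct (Hl a Ha) as (p & Hp & Hlt); specialize (Hmin p Hp).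
      apply Rnot_lt_le; intros Hab.
      destruct (proj2_sig p) as [_ Hfar]; apply (Hfar b); [| assumption].
      pose proof (d_triangle (fst (proj1_sig p)) a b); lra.
Qed.

(** * The Eilenberg-Otto theorem for a cube with coordinates [h] and parametrisation [G] *)

Section Cube.
Variables (E : X -> Prop) (n : nat) (h : nat -> X -> R) (G : (nat -> R) -> X) (lo hi : R).
Hypothesis lo_lt_hi : lo < hi.
Hypothesis compact_E : compact d E.
Let Q (u : nat -> R) : Prop := forall i, (i < n)%nat -> lo <= u i <= hi.
Let near (u : nat -> R) (y : X) (r : R) : Prop :=
  forall i, (i < n)%nat -> Rabs (u i - h i y) < r.
Hypothesis continuous_h : forall i y eps, (i < n)%nat -> E y -> 0 < eps ->
  exists r, 0 < r /\ forall z, E z -> d y z < r -> Rabs (h i z - h i y) < eps.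
Hypothesis continuous_G : forall y eps, E y -> 0 < eps ->
  exists r, 0 < r /\ forall u, Q u -> near u y r -> d y (G u) < eps.
Hypothesis G_in_E : forall u, Q u -> E (G u).
Hypothesis h_G : forall u i, Q u -> (i < n)%nat -> h i (G u) = u i.

(** A Lebesgue number measured in coordinates rather than by [d], so that it can be compared with
    the mesh of a grid. *)
Lemma lebesgue_number {A : Type} (U : A -> X -> Prop) :
  (forall a, is_open d (U a)) -> (forall y, E y -> exists a, U a y) ->
  exists r, 0 < r /\ forall y, E y -> exists a, forall u, Q u -> near u y r -> U a (G u).
Proof.
  intros HU Hcov.
  (* The covering sets must be open in all of [X], while [h] is continuous only on [E]. They
     therefore consist of the points with a ball whose points in [E] all have coordinates close to
     those of the centre [fst p]. *)
  destruct (compact_E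
    {p : X * R | 0 < snd p /\ exists a, forall u, Q u -> near u (fst p) (2 * snd p) -> U a (G u)}
    (fun p z => exists r, 0 < r /\ forall z', E z' -> d z z' < r ->
      forall i, (i < n)%nat ->
        Rabs (h i z' - h i (fst (proj1_sig p))) < snd (proj1_sig p))) as [l Hl].
  - intros p z (r & Hr & Hz); exists r; split; [assumption |]; intros z1 Hz1.
    exists (r - d z z1); split; [lra |]; intros z' Hz' Hlt; apply Hz; [assumption |].
    pose proof (d_triangle z z1 z'); lra.
  - intros y Hy; destruct (Hcov y Hy) as [a Ha].
    destruct (HU a y Ha) as (eps & Heps & Hball).
    destruct (continuous_G y eps Hy Heps) as (r & Hr & HG).
    assert (Hp : 0 < snd (y, r / 2) /\ exists a, forall u, Q u ->
      near u (fst (y, r / 2)) (2 * snd (y, r / 2)) -> U a (G u)).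
    { simpl; split; [lra |]; exists a; intros u Hu Hn; apply Hball, HG; [assumption |].
      replace r with (2 * (r / 2)) by lra; assumption. }
    exists (exist _ (y, r / 2) Hp); simpl.
    destruct (uniform_radius_lt n (fun i s => forall z', E z' -> d y z' < s ->
      Rabs (h i z' - h i y) < r / 2)) as (s & Hs & Hcont).
    + intros i s s' Hs H z' Hz' Hlt; apply H; [assumption | lra].
    + intros i Hi; apply continuous_h; [assumption | assumption | lra].
    + exists s; split; [assumption |]; intros z' Hz' Hlt i Hi; apply Hcont; assumption.
  - destruct (uniform_radius l (fun p r => r <= snd (proj1_sig p))) as (r & Hr & Hmin).
    + intros p s s' Hs; lra.
    + intros p _; exists (snd (proj1_sig p)); split; [apply (proj2_sig p) | lra].
    + exists r; split; [assumption |]; intros y Hy.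
      destruct (Hl y Hy) as (p & Hp & s & Hs & Hlt); specialize (Hmin p Hp).
      destruct (proj2_sig p) as [_ [a Ha]]; exists a; intros u Hu Hn; apply Ha; [assumption |].
      intros i Hi; specialize (Hn i Hi).
      assert (Rabs (h i y - h i (fst (proj1_sig p))) < snd (proj1_sig p))
        by (apply Hlt; [assumption | rewrite d_refl |]; assumption).
      pose proof (Rabs_triang (u i - h i y) (h i y - h i (fst (proj1_sig p)))) as Htri.
      replace (u i - h i y + (h i y - h i (fst (proj1_sig p))))
        with (u i - h i (fst (proj1_sig p))) in Htri by ring; lra.
Qed.

(** Otherwise the [U i] and [V i] cover [E]. On a grid finer than the Lebesgue number each cell lies
    in a single one of them, which is incompatible with a cell on which no label is constant. *)
Theorem partitions_meet (U V : nat -> X -> Prop) :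
  (forall i, is_open d (U i)) -> (forall i, is_open d (V i)) ->
  (forall i y, (i < n)%nat -> E y -> U i y -> ~ V i y) ->
  (forall i y, (i < n)%nat -> E y -> h i y = lo -> ~ V i y) ->
  (forall i y, (i < n)%nat -> E y -> h i y = hi -> ~ U i y) ->
  exists y, E y /\ forall i, (i < n)%nat -> ~ U i y /\ ~ V i y.
Proof.
  intros HU HV Hdis Hlo Hhi; apply NNPP; intros Hno.
  destruct (lebesgue_number (A := {i | (i < n)%nat} * bool)
    (fun a => if snd a then U (proj1_sig (fst a)) else V (proj1_sig (fst a))))
    as (r & Hr & Hleb).
  { intros [i []]; simpl; auto. }
  { intros y Hy; apply NNPP; intros Hn; apply Hno; exists y; split; [assumption |].
    intros i Hi; split; intros H; apply Hn;
      [exists (exist _ i Hi, true) | exists (exist _ i Hi, false)]; assumption. }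
  (* [m] is taken so large that the mesh [(hi - lo) / INR m] is below the Lebesgue number. *)
  destruct (archimed_cor1 (r / (hi - lo))) as (m & Hm & Hm0).
  { apply Rdiv_lt_0_compat; lra. }
  assert (HmR : 0 < INR m) by (apply lt_0_INR; assumption).
  assert (Hmesh : (hi - lo) / INR m < r).
  { apply (Rmult_lt_compat_l (hi - lo)) in Hm; [| lra].
    unfold Rdiv; replace r with ((hi - lo) * (r / (hi - lo))) by (field; lra); assumption. }
  (* Truncating at [m] keeps [pt z] in the cube for every [z], including those outside the grid. *)
  set (pt := fun (z : nat -> nat) i => lo + INR (Nat.min (z i) m) * ((hi - lo) / INR m)).
  assert (Hstep : 0 < (hi - lo) / INR m) by (apply Rdiv_lt_0_compat; lra).
  assert (HQ : forall z, Q (pt z)).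
  { intros z i _; unfold pt.
    assert (0 <= INR (Nat.min (z i) m) <= INR m) as [Ha Hb]
      by (split; [apply pos_INR | apply le_INR; lia]).
    split; [nra |].
    apply (Rmult_le_compat_r ((hi - lo) / INR m)) in Hb; [| lra].
    replace (INR m * ((hi - lo) / INR m)) with (hi - lo) in Hb by (field; lra); lra. }
  assert (Hnear : forall z z', (forall j, (z j <= z' j <= S (z j))%nat) ->
    near (pt z') (G (pt z)) r).
  { intros z z' Hz i Hi; rewrite h_G by auto; unfold pt.
    specialize (Hz i).
    assert (Nat.min (z' i) m = Nat.min (z i) m \/ Nat.min (z' i) m = S (Nat.min (z i) m))
      as [-> | ->] by lia; [| rewrite S_INR].
    - rewrite Rminus_diag, Rabs_R0; assumption.
    - rewrite Rabs_pos_eq; lra. }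
  (* Label 0 stands for membership in [U i]; on the two faces the value is prescribed, to meet the
     boundary conditions of [kuhn] literally. *)
  set (lab := fun i (z : nat -> nat) =>
    if Nat.eq_dec (z i) 0 then false else if Nat.eq_dec (z i) m then true
    else if excluded_middle_informative (U i (G (pt z))) then false else true).
  destruct (kuhn m lab n) as (z & Hz & Hcell).
  { intros i z _ E0; unfold lab; rewrite E0; reflexivity. }
  { intros i z _ E0; unfold lab.
    destruct (Nat.eq_dec (z i) 0); [lia |]; destruct (Nat.eq_dec (z i) m); [reflexivity | lia]. }
  (* If the cell lies in [U i], the vertex with label 1 contradicts this or [Hhi]; if it lies in
     [V i], the vertex with label 0 contradicts [Hlo] or [Hdis]. *)
  destruct (Hleb (G (pt z)) (G_in_E _ (HQ z))) as ([[i Hi] []] & Ha); simpl in Ha;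
    destruct (Hcell i Hi) as (z1 & z2 & H1 & H2 & L1 & L2).
  - specialize (Ha _ (HQ z2) (Hnear _ _ H2)); unfold lab in L2.
    destruct (Nat.eq_dec (z2 i) 0); [discriminate |].
    destruct (Nat.eq_dec (z2 i) m) as [Em |].
    + apply (Hhi i (G (pt z2))); auto; rewrite h_G by auto; unfold pt.
      rewrite Em, Nat.min_id; field; lra.
    + destruct (excluded_middle_informative _); [discriminate | contradiction].
  - specialize (Ha _ (HQ z1) (Hnear _ _ H1)); unfold lab in L1.
    destruct (Nat.eq_dec (z1 i) 0) as [E0 |].
    + apply (Hlo i (G (pt z1))); auto; rewrite h_G by auto; unfold pt.
      rewrite E0; simpl; lra.
    + destruct (Nat.eq_dec (z1 i) m); [discriminate |].
      destruct (excluded_middle_informative _) as [HUi |]; [| discriminate].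
      apply (Hdis i (G (pt z1))); auto.
Qed.
End Cube.
End Topology.

(** * Semi-decidable relations *)

Local Notation var0 v := (hd 0%nat v).
Local Notation var1 v := (hd 0%nat (tl v)).
Local Notation var2 v := (hd 0%nat (tl (tl v))).
Local Notation var3 v := (hd 0%nat (tl (tl (tl v)))).

Section Computability.
Local Open Scope nat_scope.

(* Functions and relations of several variables are written on environments: [v] lists the
   values of the variables, the most recently bound one first. *)
Definition Comp (k : nat) (F : list nat -> nat) : Prop :=
  exists p, forall v, length v = k -> reval p v (F v).

Definition CompEnv (k j : nat) (E : list nat -> list nat) : Prop :=
  exists ps, length ps = j /\
    forall v, length v = k -> Forall2 (fun p y => reval p v y) ps (E v).

Lemma Comp_ext k F G : (forall v, length v = k -> F v = G v) -> Comp k G -> Comp k F.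
Proof. intros H [p Hp]; exists p; intros v Hv; rewrite H by assumption; auto. Qed.

Lemma Comp_nth k i : Comp k (fun v => nth i v 0).
Proof. exists (RProj i); intros; constructor. Qed.

Lemma Comp_var k i : Comp k (fun v => hd 0 (Nat.iter i (@tl nat) v)).
Proof.
  apply (Comp_ext k _ (fun v => nth i v 0)); [| apply Comp_nth].
  intros v _; revert v; induction i as [|i IH]; intros v; [destruct v; reflexivity |].
  rewrite Nat.iter_succ_r, IH; destruct v; [destruct i |]; reflexivity.
Qed.

Lemma CompEnv_id k : CompEnv k k (fun v => v).
Proof.
  exists (map RProj (seq 0 k)); split; [rewrite length_map, length_seq; reflexivity |].
  intros v Hv.
  assert (H : forall u w, Forall2 (fun p y => reval p (u ++ w) y)
    (map RProj (seq (length u) (length w))) w).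
  { clear; intros u w; revert u; induction w as [|a w IH]; intros u; simpl; constructor.
    - replace a with (nth (length u) (u ++ a :: w) 0) at 2 by apply nth_middle; constructor.
    - specialize (IH (u ++ [a])); rewrite <- app_assoc, length_app, Nat.add_1_r in IH; exact IH. }
  specialize (H [] v); simpl in H; rewrite Hv in H; exact H.
Qed.

Lemma CompEnv_nil k : CompEnv k 0 (fun _ => []).
Proof. exists []; split; [reflexivity | constructor]. Qed.

Lemma CompEnv_cons k j F E :
  Comp k F -> CompEnv k j E -> CompEnv k (S j) (fun v => F v :: E v).
Proof.
  intros [p Hp] (ps & Hl & Hps); exists (p :: ps); split; [simpl; congruence |].
  intros v Hv; constructor; auto.
Qed.

Lemma CompEnv_tl k j E : CompEnv k (S j) E -> CompEnv k j (fun v => tl (E v)).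
Proof.
  intros (ps & Hl & Hps); exists (tl ps); split; [destruct ps; simpl in *; congruence |].
  intros v Hv; destruct (Hps v Hv); simpl; [constructor | assumption].
Qed.

Lemma Comp_env k j F E : Comp j F -> CompEnv k j E -> Comp k (fun v => F (E v)).
Proof.
  intros [p Hp] (ps & Hl & Hps); exists (RComp p ps); intros v Hv.
  apply ev_comp with (E v); [auto |]; apply Hp.
  rewrite <- Hl; symmetry; eapply Forall2_length, Hps; assumption.
Qed.

Lemma Comp_app1 k f F : computable1 f -> Comp k F -> Comp k (fun v => f (F v)).
Proof.
  intros [p Hp] HF.
  apply (Comp_env k 1 (fun v => f (var0 v)) (fun v => [F v])).
  - exists p; intros [|a [|b v]]; try discriminate; intros _; apply Hp.
  - apply CompEnv_cons, CompEnv_nil; assumption.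
Qed.

Lemma Comp_app2 k f F G :
  computable2 f -> Comp k F -> Comp k G -> Comp k (fun v => f (F v) (G v)).
Proof.
  intros [p Hp] HF HG.
  apply (Comp_env k 2 (fun v => f (var0 v) (var1 v)) (fun v => [F v; G v])).
  - exists p; intros [|a [|b [|c v]]]; try discriminate; intros _; apply Hp.
  - apply CompEnv_cons, CompEnv_cons, CompEnv_nil; assumption.
Qed.

Lemma Comp_app3 k f F G H : computable3 f ->
  Comp k F -> Comp k G -> Comp k H -> Comp k (fun v => f (F v) (G v) (H v)).
Proof.
  intros [p Hp] HF HG HH.
  apply (Comp_env k 3 (fun v => f (var0 v) (var1 v) (var2 v))
    (fun v => [F v; G v; H v])).
  - exists p; intros [|a [|b [|c [|e v]]]]; try discriminate; intros _; apply Hp.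
  - apply CompEnv_cons, CompEnv_cons, CompEnv_cons, CompEnv_nil; assumption.
Qed.

Lemma Comp_S k F : Comp k F -> Comp k (fun v => S (F v)).
Proof.
  apply (Comp_app1 k S); exists RSucc; constructor.
Qed.

Lemma Comp_const k c : Comp k (fun _ => c).
Proof. induction c; [exists RZero; constructor | apply Comp_S; assumption]. Qed.

Fixpoint prec (a : nat) (g : nat -> nat -> nat) (n : nat) : nat :=
  match n with 0 => a | S m => g m (prec a g m) end.

Lemma Comp_rec k F G H : Comp k F ->
  Comp (S (S k)) (fun v => G (var0 v) (var1 v) (tl (tl v))) -> Comp k H ->
  Comp k (fun v => prec (F v) (fun m z => G m z v) (H v)).
Proof.
  intros [pF HF] [pG HG] HH.
  apply (Comp_env k (S k)
    (fun v => prec (F (tl v)) (fun m z => G m z (tl v)) (var0 v))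
    (fun v => H v :: v)); [| apply CompEnv_cons; [assumption | apply CompEnv_id]].
  exists (RRec pF pG); intros [|n v] Hv; [discriminate |]; injection Hv as Hv; simpl.
  induction n as [|n IH]; simpl; [constructor; auto |].
  eapply ev_recS; [exact IH |].
  apply (HG (n :: _ :: v)); simpl; congruence.
Qed.

Definition if0 (n a b : nat) : nat := match n with 0 => a | _ => b end.

Lemma Comp_if0 k F G H :
  Comp k F -> Comp k G -> Comp k H -> Comp k (fun v => if0 (F v) (G v) (H v)).
Proof.
  intros HF HG HH.
  apply (Comp_ext k _ (fun v => prec (G v) (fun _ _ => H v) (F v))).
  - intros v _; destruct (F v); reflexivity.
  - apply Comp_rec; [assumption | | assumption].
    apply (Comp_env _ k H); [assumption |]; apply CompEnv_tl, CompEnv_tl, CompEnv_id.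
Qed.

Lemma Comp_pred k F : Comp k F -> Comp k (fun v => pred (F v)).
Proof.
  intros HF; apply (Comp_ext k _ (fun v => prec 0 (fun m _ => m) (F v))).
  - intros v _; destruct (F v); reflexivity.
  - apply (Comp_rec k (fun _ => 0) (fun m _ _ => m));
      [apply Comp_const | exact (Comp_var _ 0) | assumption].
Qed.

Lemma Comp_add k F G : Comp k F -> Comp k G -> Comp k (fun v => F v + G v).
Proof.
  intros HF HG.
  apply (Comp_ext k _ (fun v => prec (F v) (fun _ z => S z) (G v))).
  - intros v _; induction (G v); simpl; lia.
  - apply (Comp_rec k F (fun _ z _ => S z));
      [assumption | apply Comp_S; exact (Comp_var _ 1) | assumption].
Qed.

Lemma Comp_sub k F G : Comp k F -> Comp k G -> Comp k (fun v => F v - G v).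
Proof.
  intros HF HG.
  apply (Comp_ext k _ (fun v => prec (F v) (fun _ z => pred z) (G v))).
  - intros v _; induction (G v); simpl; lia.
  - apply (Comp_rec k F (fun _ z _ => pred z));
      [assumption | apply Comp_pred; exact (Comp_var _ 1) | assumption].
Qed.

(** What matters is whether the value is zero: [nsum] acts as a bounded existential and [nprod] as a
    bounded universal quantifier. *)
Definition nsum (n : nat) (f : nat -> nat) : nat :=
  prec 0 (fun m z => f m + z) n.
Definition nprod (n : nat) (f : nat -> nat) : nat :=
  prec 1 (fun m z => if0 (f m) 0 z) n.

Lemma nsum_nonzero n f : nsum n f <> 0 <-> exists t, t < n /\ f t <> 0.
Proof.
  unfold nsum; induction n as [|n IH]; simpl.
  - split; [congruence | intros (t & Ht & _); lia].
  - split.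
    + intros H; destruct (Nat.eq_dec (f n) 0) as [E | E].
      * rewrite E in H; apply IH in H as (t & Ht & Hf); exists t; split; [lia | assumption].
      * exists n; split; [lia | assumption].
    + intros (t & Ht & Hf); destruct (Nat.eq_dec t n) as [-> | Hne]; [lia |].
      assert (prec 0 (fun m z => f m + z) n <> 0); [| lia].
      apply IH; exists t; split; [lia | assumption].
Qed.

Lemma nprod_nonzero n f : nprod n f <> 0 <-> forall t, t < n -> f t <> 0.
Proof.
  unfold nprod; induction n as [|n IH]; simpl; [split; [lia | discriminate] |].
  split.
  - intros H t Ht; destruct (f n) eqn:E; [contradiction H; reflexivity |].
    simpl in H; destruct (Nat.eq_dec t n) as [-> |]; [congruence |].
    apply (proj1 IH H); lia.
  - intros H; specialize (H n) as Hn; destruct (f n); simpl; [lia |].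
    apply IH; intros t Ht; apply H; lia.
Qed.

Lemma Comp_nsum k B f : Comp (S k) (fun v => f (var0 v) (tl v)) -> Comp k B ->
  Comp k (fun v => nsum (B v) (fun t => f t v)).
Proof.
  intros Hf HB; apply (Comp_rec k (fun _ => 0) (fun m z v => f m v + z));
    [apply Comp_const | | assumption].
  apply Comp_add; [| exact (Comp_var _ 1)].
  apply (Comp_env _ (S k) _ (fun v => var0 v :: tl (tl v)) Hf).
  apply CompEnv_cons; [exact (Comp_var _ 0) | apply CompEnv_tl, CompEnv_tl, CompEnv_id].
Qed.

Lemma Comp_nprod k B f : Comp (S k) (fun v => f (var0 v) (tl v)) -> Comp k B ->
  Comp k (fun v => nprod (B v) (fun t => f t v)).
Proof.
  intros Hf HB; apply (Comp_rec k (fun _ => 1) (fun m z v => if0 (f m v) 0 z));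
    [apply Comp_const | | assumption].
  apply Comp_if0; [| apply Comp_const | exact (Comp_var _ 1)].
  apply (Comp_env _ (S k) _ (fun v => var0 v :: tl (tl v)) Hf).
  apply CompEnv_cons; [exact (Comp_var _ 0) | apply CompEnv_tl, CompEnv_tl, CompEnv_id].
Qed.

Lemma Comp_mul k F G : Comp k F -> Comp k G -> Comp k (fun v => F v * G v).
Proof.
  intros HF HG; apply (Comp_ext k _ (fun v => nsum (F v) (fun _ => G v))).
  - intros v _; unfold nsum; induction (F v); simpl; congruence.
  - apply (Comp_nsum k F (fun _ v => G v)); [| assumption].
    apply (Comp_env _ k G); [assumption | apply CompEnv_tl, CompEnv_id].
Qed.

Lemma Comp_pow2 k F : Comp k F -> Comp k (fun v => 2 ^ F v).
Proof.
  intros HF.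
  apply (Comp_ext k _ (fun v => prec 1 (fun _ z => z + z) (F v))).
  - intros v _; induction (F v) as [|n IH]; simpl; [reflexivity | rewrite <- IH; lia].
  - apply (Comp_rec k (fun _ => 1) (fun _ z _ => z + z)); [apply Comp_const | | assumption].
    apply Comp_add; exact (Comp_var _ 1).
Qed.

(** The least zero is chosen by description; [RMu] finds it because [F] is total, with positive
    values before it. *)
Lemma Comp_mu F : Comp 2 (fun v => F (var0 v) (var1 v)) ->
  (forall k, exists n, F n k = 0) ->
  exists f, computable1 f /\ forall k, F (f k) k = 0.
Proof.
  intros [p Hp] Hex.
  assert (Hmin : forall k, exists n, F n k = 0 /\ forall m, m < n -> F m k <> 0).
  { intros k; destruct (Hex k) as [n Hn]; revert Hn.
    induction n as [n IH] using lt_wf_ind; intros Hn.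
    destruct (classic (exists m, m < n /\ F m k = 0)) as [(m & Hm & E) | H];
      [exact (IH m Hm E) |].
    exists n; split; [assumption |]; intros m Hm E; apply H; exists m; tauto. }
  set (f k := proj1_sig (constructive_indefinite_description _ (Hmin k))).
  assert (Hf : forall k, F (f k) k = 0 /\ forall m, m < f k -> F m k <> 0)
    by (intros k; exact (proj2_sig (constructive_indefinite_description _ (Hmin k)))).
  exists f; split; [| apply Hf].
  exists (RMu p); intros k; destruct (Hf k) as [H0 Hlt]; apply ev_mu.
  - rewrite <- H0; apply (Hp [f k; k] eq_refl).
  - intros m Hm; specialize (Hlt m Hm); exists (pred (F m k)).
    replace (S (pred (F m k))) with (F m k) by lia; apply (Hp [m; k] eq_refl).
Qed.

(** Semi-decidability through a computable test at stage [w]. Monotonicity in [w] allows witnesses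
    to be merged by taking the larger stage, so no pairs have to be coded. *)
Definition Sig (k : nat) (P : list nat -> Prop) : Prop :=
  exists F : nat -> list nat -> nat,
    Comp (S k) (fun v => F (var0 v) (tl v)) /\
    forall v, length v = k ->
      (forall w w', w <= w' -> F w v <> 0 -> F w' v <> 0) /\
      (P v <-> exists w, F w v <> 0).

Lemma Sig_ext k P Q : (forall v, length v = k -> (P v <-> Q v)) -> Sig k Q -> Sig k P.
Proof.
  intros H (F & HF & Hs); exists F; split; [assumption |].
  intros v Hv; rewrite H by assumption; auto.
Qed.

Lemma Sig_env k j P E : Sig j P -> CompEnv k j E -> Sig k (fun v => P (E v)).
Proof.
  intros (F & HF & HP) HE; exists (fun w v => F w (E v)); split.
  - apply (Comp_env _ (S j) _ (fun v => var0 v :: E (tl v)) HF).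
    apply CompEnv_cons; [exact (Comp_var _ 0) |].
    destruct (CompEnv_tl _ _ _ (CompEnv_id (S k))) as (qs & Hqs & Hq).
    destruct HE as (ps & Hps & Hp).
    exists (map (fun p => RComp p qs) ps); split; [rewrite length_map; assumption |].
    intros v Hv; specialize (Hq v Hv).
    assert (Hl : length (tl v) = k) by (destruct v; simpl in *; congruence).
    specialize (Hp _ Hl); clear Hps; induction Hp; simpl; [constructor |].
    constructor; [econstructor; eassumption | assumption].
  - intros v Hv; apply HP; destruct HE as (ps & <- & Hp).
    symmetry; eapply Forall2_length, Hp; assumption.
Qed.

Lemma Sig_app1 k (P : nat -> Prop) F :
  Sig 1 (fun v => P (var0 v)) -> Comp k F -> Sig k (fun v => P (F v)).
Proof.
  intros HP HF; apply (Sig_env k 1 _ (fun v => [F v]) HP).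
  apply CompEnv_cons, CompEnv_nil; assumption.
Qed.

Lemma Sig_app2 k (P : nat -> nat -> Prop) F G :
  Sig 2 (fun v => P (var0 v) (var1 v)) -> Comp k F -> Comp k G ->
  Sig k (fun v => P (F v) (G v)).
Proof.
  intros HP HF HG; apply (Sig_env k 2 _ (fun v => [F v; G v]) HP).
  apply CompEnv_cons, CompEnv_cons, CompEnv_nil; assumption.
Qed.

Lemma Sig_nonzero k F : Comp k F -> Sig k (fun v => F v <> 0).
Proof.
  intros HF; exists (fun _ => F); split.
  - apply (Comp_env _ k F); [assumption | apply CompEnv_tl, CompEnv_id].
  - intros v _; split; [auto |]; split; [exists 0; assumption | intros [_ H]; assumption].
Qed.

Lemma Sig_lt k F G : Comp k F -> Comp k G -> Sig k (fun v => F v < G v).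
Proof.
  intros HF HG; apply (Sig_ext k _ (fun v => G v - F v <> 0)); [intros; lia |].
  apply Sig_nonzero, Comp_sub; assumption.
Qed.

Lemma Sig_and k P Q : Sig k P -> Sig k Q -> Sig k (fun v => P v /\ Q v).
Proof.
  intros (F & HF & HP) (G & HG & HQ); exists (fun w v => F w v * G w v); split.
  - apply (Comp_mul _ (fun v => F (var0 v) (tl v)) (fun v => G (var0 v) (tl v))); assumption.
  - intros v Hv; destruct (HP v Hv) as [MF ->]; destruct (HQ v Hv) as [MG ->].
    assert (Hmul : forall a b, a * b <> 0 <-> a <> 0 /\ b <> 0) by (intros; nia).
    split.
    + intros w w' Hw; rewrite !Hmul; intros []; split; eauto.
    + split.
      * intros [[w Hw] [w' Hw']]; exists (max w w'); rewrite Hmul.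
        split; [apply (MF w) | apply (MG w')]; auto; lia.
      * intros [w Hw]; rewrite Hmul in Hw; split; exists w; tauto.
Qed.

Lemma Sig_or k P Q : Sig k P -> Sig k Q -> Sig k (fun v => P v \/ Q v).
Proof.
  intros (F & HF & HP) (G & HG & HQ); exists (fun w v => F w v + G w v); split.
  - apply (Comp_add _ (fun v => F (var0 v) (tl v)) (fun v => G (var0 v) (tl v))); assumption.
  - intros v Hv; destruct (HP v Hv) as [MF ->]; destruct (HQ v Hv) as [MG ->].
    assert (Hadd : forall a b, a + b <> 0 <-> a <> 0 \/ b <> 0) by (intros; lia).
    split.
    + intros w w' Hw; rewrite !Hadd; intros []; eauto.
    + split.
      * intros [[w Hw] | [w Hw]]; exists w; rewrite Hadd; tauto.
      * intros [w Hw]; rewrite Hadd in Hw; destruct Hw; [left | right]; exists w; assumption.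
Qed.

Lemma Sig_eq k F G : Comp k F -> Comp k G -> Sig k (fun v => F v = G v).
Proof.
  intros HF HG; apply (Sig_ext k _ (fun v => F v < S (G v) /\ G v < S (F v))); [intros; lia |].
  apply Sig_and; apply Sig_lt; try apply Comp_S; assumption.
Qed.

(** Dovetailing: stage [w] tries the witnesses [t <= w], each at stage [w]. *)
Lemma Sig_ex k P : Sig (S k) (fun v => P (var0 v) (tl v)) -> Sig k (fun v => exists t, P t v).
Proof.
  intros (F & HF & HP).
  exists (fun w v => nsum (S w) (fun t => F w (t :: v))); split.
  - apply (Comp_nsum _ (fun v => S (var0 v)) (fun t v => F (var0 v) (t :: tl v)));
      [| apply Comp_S; exact (Comp_var _ 0)].
    apply (Comp_env _ (S (S k)) _ (fun v => var1 v :: var0 v :: tl (tl v)) HF).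
    apply CompEnv_cons; [exact (Comp_var _ 1) |].
    apply CompEnv_cons; [exact (Comp_var _ 0) | apply CompEnv_tl, CompEnv_tl, CompEnv_id].
  - intros v Hv.
    assert (HPt : forall t, (forall w w', w <= w' -> F w (t :: v) <> 0 -> F w' (t :: v) <> 0) /\
      (P t v <-> exists w, F w (t :: v) <> 0))
      by (intros t; apply (HP (t :: v)); simpl; congruence).
    split.
    + intros w w' Hw; rewrite !nsum_nonzero; intros (t & Ht & HF'); exists t.
      split; [lia |]; apply (proj1 (HPt t) w w'); assumption.
    + split.
      * intros [t Ht]; apply HPt in Ht as [w Hw]; exists (max t w); apply nsum_nonzero.
        exists t; split; [lia |]; apply (proj1 (HPt t) w); [lia | assumption].
      * intros [w Hw]; apply nsum_nonzero in Hw as (t & _ & Ht).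
        exists t; apply HPt; exists w; assumption.
Qed.

Lemma common_stage (f : nat -> nat -> nat) n :
  (forall t w w', w <= w' -> f t w <> 0 -> f t w' <> 0) ->
  (forall t, t < n -> exists w, f t w <> 0) -> exists w, forall t, t < n -> f t w <> 0.
Proof.
  intros Hmono; induction n as [|n IH]; intros H; [exists 0; lia |].
  destruct IH as [w Hw]; [intros; apply H; lia |]; destruct (H n) as [w' Hw']; [lia |].
  exists (max w w'); intros t Ht; destruct (Nat.eq_dec t n) as [-> |].
  - apply (Hmono n w'); [lia | assumption].
  - apply (Hmono t w); [lia | apply Hw; lia].
Qed.

(** By monotonicity the finitely many instances are all confirmed at a common stage. *)
Lemma Sig_all k B P : Sig (S k) (fun v => P (var0 v) (tl v)) -> Comp k B ->
  Sig k (fun v => forall t, t < B v -> P t v).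
Proof.
  intros (F & HF & HP) HB.
  exists (fun w v => nprod (B v) (fun t => F w (t :: v))); split.
  - apply (Comp_nprod _ (fun v => B (tl v)) (fun t v => F (var0 v) (t :: tl v))).
    + apply (Comp_env _ (S (S k)) _ (fun v => var1 v :: var0 v :: tl (tl v)) HF).
      apply CompEnv_cons; [exact (Comp_var _ 1) |].
      apply CompEnv_cons; [exact (Comp_var _ 0) | apply CompEnv_tl, CompEnv_tl, CompEnv_id].
    + apply (Comp_env _ k B); [assumption | apply CompEnv_tl, CompEnv_id].
  - intros v Hv.
    assert (HPt : forall t, (forall w w', w <= w' -> F w (t :: v) <> 0 -> F w' (t :: v) <> 0) /\
      (P t v <-> exists w, F w (t :: v) <> 0))
      by (intros t; apply (HP (t :: v)); simpl; congruence).
    split.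
    + intros w w' Hw; rewrite !nprod_nonzero; intros H t Ht.
      apply (proj1 (HPt t) w w'); auto.
    + split.
      * intros H; destruct (common_stage (fun t w => F w (t :: v)) (B v)) as [w Hw].
        -- intros t; apply HPt.
        -- intros t Ht; apply HPt, H, Ht.
        -- exists w; apply nprod_nonzero, Hw.
      * intros [w Hw] t Ht; rewrite nprod_nonzero in Hw; apply HPt; exists w; auto.
Qed.

(** Two successive searches: [g k] is the first stage at which some [y <= g k] passes the test, and
    [f k] is the least [y] passing at that stage. *)
Theorem Sig_choice (P : nat -> nat -> Prop) : Sig 2 (fun v => P (var0 v) (var1 v)) ->
  (forall k, exists y, P y k) -> exists f, computable1 f /\ forall k, P (f k) k.
Proof.
  intros (F & HF & HP) Hex.
  assert (HPy : forall y k, P y k <-> exists w, F w [y; k] <> 0)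
    by (intros y k; apply (HP [y; k]); reflexivity).
  assert (Hif : forall a, if0 a 1 0 = 0 <-> a <> 0)
    by (intros []; simpl; split; congruence).
  destruct (Comp_mu (fun w k => if0 (nsum (S w) (fun y => F w [y; k])) 1 0)) as (g & Hg & Hgk).
  - apply Comp_if0; [| apply Comp_const | apply Comp_const].
    apply (Comp_nsum _ (fun v => S (var0 v)) (fun y v => F (var0 v) [y; var1 v]));
      [| apply Comp_S; exact (Comp_var _ 0)].
    apply (Comp_env _ 3 _ (fun v => [var1 v; var0 v; var2 v]) HF).
    repeat apply CompEnv_cons; [exact (Comp_var _ 1) | exact (Comp_var _ 0) |
      exact (Comp_var _ 2) | apply CompEnv_nil].
  - intros k; destruct (Hex k) as [y Hy]; apply HPy in Hy as [w Hw]; exists (max w y).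
    apply Hif, nsum_nonzero; exists y; split; [lia |].
    apply (proj1 (HP [y; k] eq_refl) w); [lia | assumption].
  - destruct (Comp_mu (fun y k => if0 (F (g k) [y; k]) 1 0)) as (f & Hf & Hfk).
    + apply Comp_if0; [| apply Comp_const | apply Comp_const].
      apply (Comp_env _ 3 _ (fun v => [g (var1 v); var0 v; var1 v]) HF).
      repeat apply CompEnv_cons; [apply Comp_app1; [assumption | exact (Comp_var _ 1)] |
        exact (Comp_var _ 0) | exact (Comp_var _ 1) | apply CompEnv_nil].
    + intros k; specialize (Hgk k); apply Hif, nsum_nonzero in Hgk as (y & _ & Hy).
      exists y; apply Hif; assumption.
    + exists f; split; [assumption |]; intros k; apply HPy; exists (g k); apply Hif, Hfk.
Qed.

(** * Halting is semi-decidable: evaluation with fuel *)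

Lemma rf_nested_ind (P : rf -> Prop) :
  P RZero -> P RSucc -> (forall i, P (RProj i)) ->
  (forall f gs, P f -> Forall P gs -> P (RComp f gs)) ->
  (forall f g, P f -> P g -> P (RRec f g)) -> (forall f, P f -> P (RMu f)) ->
  forall p, P p.
Proof.
  intros HZ HS HP HC HR HM; fix IH 1; intros [| | i | f gs | f g | f].
  - exact HZ.
  - exact HS.
  - apply HP.
  - apply HC; [apply IH |]; induction gs; constructor; [apply IH | assumption].
  - apply HR; apply IH.
  - apply HM, IH.
Qed.

(* [E w v] is [S y] when [w] units of fuel suffice to see that [p] outputs [y] on [v],
   and [0] otherwise. *)
Definition fueled (p : rf) (k : nat) (E : nat -> list nat -> nat) : Prop :=
  Comp (S k) (fun v => E (var0 v) (tl v)) /\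
  forall v, length v = k ->
    (forall w w' y, w <= w' -> E w v = S y -> E w' v = S y) /\
    (forall y, reval p v y <-> exists w, E w v = S y).

(** A nonzero [A w v] signals that all of [gs] have halted with fuel [w]; [E w v] then lists their
    values. *)
Lemma fueled_list gs k : Forall (fun g => forall k, exists E, fueled g k E) gs ->
  exists (A : nat -> list nat -> nat) (E : nat -> list nat -> list nat),
    Comp (S k) (fun v => A (var0 v) (tl v)) /\
    CompEnv (S k) (length gs) (fun v => E (var0 v) (tl v)) /\
    forall v, length v = k ->
      (forall w w', w <= w' -> A w v <> 0 -> A w' v <> 0 /\ E w' v = E w v) /\
      (forall ys, Forall2 (fun g y => reval g v y) gs ys <-> exists w, A w v <> 0 /\ E w v = ys).
Proof.
  intros H; induction H as [|g gs Hg _ (A & E & HA & HE & Hs)].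
  - exists (fun _ _ => 1), (fun _ _ => []); split; [apply Comp_const |].
    split; [apply CompEnv_nil |]; intros v Hv; split; [auto |]; intros ys; split.
    + intros Hys; inversion Hys; exists 0; auto.
    + intros (w & _ & <-); constructor.
  - destruct (Hg k) as (e & He & Hes).
    exists (fun w v => if0 (e w v) 0 (A w v)), (fun w v => pred (e w v) :: E w v).
    split; [apply Comp_if0; auto using Comp_const |].
    split; [apply CompEnv_cons; [apply Comp_pred |]; assumption |].
    intros v Hv; destruct (Hs v Hv) as [Hm Hr]; destruct (Hes v Hv) as [Hme Hre]; split.
    + intros w w' Hw Hne; destruct (e w v) as [|y] eqn:Ey; simpl in Hne; [congruence |].
      rewrite (Hme w w' y Hw Ey); destruct (Hm w w' Hw Hne) as [? ->]; auto.
    + intros ys; split.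
      * intros Hys; inversion Hys as [|? y ? ys' Hy Hys']; subst.
        apply Hre in Hy as [w1 H1]; apply Hr in Hys' as (w2 & H2 & H2').
        exists (max w1 w2); rewrite (Hme w1 (max w1 w2) y) by (assumption || lia); simpl.
        destruct (Hm w2 (max w1 w2)) as [H3 H4]; [lia | assumption |].
        split; [assumption | congruence].
      * intros (w & Hne & <-); destruct (e w v) as [|y] eqn:Ey; simpl in Hne |- *; [congruence |].
        constructor; [apply Hre; exists w; assumption | apply Hr; exists w; auto].
Qed.

(** The recursion carries coded values: [if0] propagates the code 0 of an undefined value, and
    [pred] decodes a defined one. *)
Lemma fueled_rec f g k Ef Eg : fueled f k Ef -> fueled g (S (S k)) Eg ->
  fueled (RRec f g) (S k) (fun w v => prec (Ef w (tl v))
    (fun m z => if0 z 0 (Eg w (m :: pred z :: tl v))) (var0 v)).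
Proof.
  intros [Cf Hf] [Cg Hg]; split.
  - apply (Comp_rec _ (fun v => Ef (var0 v) (tl (tl v)))
      (fun m z v => if0 z 0 (Eg (var0 v) (m :: pred z :: tl (tl v))))
      (fun v => var1 v)); [| | exact (Comp_var _ 1)].
    + apply (Comp_env _ (S k) _ (fun v => var0 v :: tl (tl v)) Cf).
      apply CompEnv_cons; [exact (Comp_var _ 0) | apply CompEnv_tl, CompEnv_tl, CompEnv_id].
    + apply Comp_if0; [exact (Comp_var _ 1) | apply Comp_const |].
      apply (Comp_env _ (S (S (S k))) _ (fun v => var2 v :: var0 v ::
        pred (var1 v) :: tl (tl (tl (tl v)))) Cg).
      apply CompEnv_cons; [exact (Comp_var _ 2) |].
      apply CompEnv_cons; [exact (Comp_var _ 0) |].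
      apply CompEnv_cons; [apply Comp_pred; exact (Comp_var _ 1) |].
      apply CompEnv_tl, CompEnv_tl, CompEnv_tl, CompEnv_tl, CompEnv_id.
  - intros [|n xs] Hv; [discriminate |]; injection Hv as Hv; cbn [hd tl].
    destruct (Hf xs Hv) as [Mf Rf].
    assert (Hg' : forall m z, (forall w w' y, w <= w' ->
        Eg w (m :: z :: xs) = S y -> Eg w' (m :: z :: xs) = S y) /\
        forall y, reval g (m :: z :: xs) y <-> exists w, Eg w (m :: z :: xs) = S y)
      by (intros; apply Hg; simpl; congruence).
    assert (M : forall n w w' y, w <= w' ->
      prec (Ef w xs) (fun m z => if0 z 0 (Eg w (m :: pred z :: xs))) n = S y ->
      prec (Ef w' xs) (fun m z => if0 z 0 (Eg w' (m :: pred z :: xs))) n = S y).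
    { intros m w w' y Hw; revert y; induction m as [|m IH]; intros y; simpl; [apply Mf, Hw |].
      destruct (prec (Ef w xs) _ m) as [|z]; simpl; [discriminate |].
      rewrite (IH z eq_refl); simpl; apply Hg', Hw. }
    split; [apply M |].
    induction n as [|n IH]; intros y; simpl.
    + rewrite <- Rf; split; intros H; [inversion H; assumption | constructor; assumption].
    + split.
      * intros H; inversion H as [| | | | | ? ? ? ? z ? H1 H2 |]; subst.
        apply IH in H1 as [w1 H1]; apply Hg' in H2 as [w2 H2].
        exists (max w1 w2); rewrite (M n w1 (max w1 w2) z) by (assumption || lia); simpl.
        apply (proj1 (Hg' n z) w2); [lia | assumption].
      * intros [w H].
        destruct (prec (Ef w xs) _ n) as [|z] eqn:Ez; simpl in H; [discriminate |].
        apply ev_recS with z; [apply IH; exists w; assumption | apply Hg'; exists w; assumption].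
Qed.

(* State of the search after inspecting the arguments below [m]: [0] while all values were
   positive, [1] when stuck on an undefined value, [S (S n)] when the zero [n] was found. *)
Definition mu_search (e : nat -> nat) (m : nat) : nat :=
  prec 0
    (fun i z => if0 z (if0 (e i) 1 (if0 (pred (e i)) (S (S i)) 0)) z) m.

Lemma mu_search_found e m n : mu_search e m = S (S n) <->
  n < m /\ e n = 1 /\ forall i, i < n -> exists z, e i = S (S z).
Proof.
  assert (Inv : (mu_search e m = 0 /\ forall i, i < m -> exists z, e i = S (S z)) \/
    (mu_search e m = 1 /\ exists i, i < m /\ e i = 0 /\ forall j, j < i -> exists z, e j = S (S z)) \/
    (exists n, mu_search e m = S (S n) /\
      n < m /\ e n = 1 /\ forall i, i < n -> exists z, e i = S (S z))).
  { unfold mu_search; induction m as [|m IH]; simpl; [left; split; [reflexivity | lia] |].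
    destruct IH as [[-> H] | [(-> & i & Hi & H) | (k & -> & Hk & H)]]; simpl.
    - destruct (e m) as [|[|z]] eqn:Em; simpl.
      + right; left; split; [reflexivity |]; exists m; auto.
      + right; right; exists m; auto.
      + left; split; [reflexivity |]; intros i Hi.
        destruct (Nat.eq_dec i m) as [-> |]; [exists z; assumption | apply H; lia].
    - right; left; split; [reflexivity |]; exists i; split; [lia | assumption].
    - right; right; exists k; split; [reflexivity |]; split; [lia | assumption]. }
  (* A code below 2 means undefined or the value zero. The first such index is unique, which keeps
     the three outcomes of [Inv] apart. *)
  assert (Uniq : forall a b, e a < 2 -> e b < 2 ->
    (forall i, i < a -> exists z, e i = S (S z)) ->
    (forall i, i < b -> exists z, e i = S (S z)) -> a = b).
  { intros a b Ha Hb Ia Ib; destruct (Nat.lt_trichotomy a b) as [H | [H | H]]; [| assumption |].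
    - destruct (Ib a H) as [z E]; lia.
    - destruct (Ia b H) as [z E]; lia. }
  split.
  - intros Hn; destruct Inv as [[E _] | [[E _] | (k & E & H)]]; try congruence.
    replace n with k by congruence; assumption.
  - intros (Hn & H1 & H2); destruct Inv as [[_ H] | [(_ & i & Hi & H0 & H) | (k & E & Hk & Hk1 & H)]].
    + destruct (H n Hn); congruence.
    + assert (i = n) by (apply Uniq; auto; lia); congruence.
    + assert (k = n) by (apply Uniq; auto; lia); congruence.
Qed.

(** [pred] merges the states 0 and 1 of the search into the code of an undefined value and turns
    [S (S n)] into the code of the output [n]. *)
Lemma fueled_mu f k Ef : fueled f (S k) Ef ->
  fueled (RMu f) k (fun w v => pred (mu_search (fun i => Ef w (i :: v)) w)).
Proof.
  intros [Cf Hf]; split.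
  - apply Comp_pred; unfold mu_search.
    assert (HE : Comp (S (S (S k))) (fun v => Ef (var2 v) (var0 v :: tl (tl (tl v))))).
    { apply (Comp_env _ (S (S k)) _ (fun v => var2 v :: var0 v :: tl (tl (tl v))) Cf).
      apply CompEnv_cons; [exact (Comp_var _ 2) |].
      apply CompEnv_cons; [exact (Comp_var _ 0) |].
      apply CompEnv_tl, CompEnv_tl, CompEnv_tl, CompEnv_id. }
    apply (Comp_rec _ (fun _ => 0) (fun i z v => if0 z (if0 (Ef (var0 v) (i :: tl v)) 1
      (if0 (pred (Ef (var0 v) (i :: tl v))) (S (S i)) 0)) z) (fun v => var0 v));
      [apply Comp_const | | exact (Comp_var _ 0)].
    apply Comp_if0; [exact (Comp_var _ 1) | | exact (Comp_var _ 1)].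
    apply Comp_if0; [exact HE | apply Comp_const |].
    apply Comp_if0; [apply Comp_pred; exact HE | | apply Comp_const].
    apply Comp_S, Comp_S; exact (Comp_var _ 0).
  - intros v Hv.
    assert (Hf' : forall i, (forall w w' y, w <= w' -> Ef w (i :: v) = S y -> Ef w' (i :: v) = S y) /\
        forall y, reval f (i :: v) y <-> exists w, Ef w (i :: v) = S y)
      by (intros; apply Hf; simpl; congruence).
    assert (Hs : forall w y, pred (mu_search (fun i => Ef w (i :: v)) w) = S y <->
      y < w /\ Ef w (y :: v) = 1 /\ forall i, i < y -> exists z, Ef w (i :: v) = S (S z)).
    { intros w y; rewrite <- (mu_search_found (fun i => Ef w (i :: v))); lia. }
    split.
    + intros w w' y Hw; rewrite !Hs; intros (H1 & H2 & H3); split; [lia |]; split.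
      * apply (proj1 (Hf' y) w); assumption.
      * intros i Hi; destruct (H3 i Hi) as [z Hz]; exists z; apply (proj1 (Hf' i) w); assumption.
    + intros y; split.
      * intros H; inversion H as [| | | | | | ? ? ? H0 Hpos]; subst.
        apply Hf' in H0 as [w0 H0].
        destruct (common_stage (fun i w => pred (Ef w (i :: v))) y) as [w1 H1].
        -- intros i w w' Hw Hne; destruct (Ef w (i :: v)) as [|z] eqn:Ez; [simpl in Hne; lia |].
           rewrite (proj1 (Hf' i) w w' z Hw Ez); assumption.
        -- intros i Hi; destruct (Hpos i Hi) as [z Hz]; apply Hf' in Hz as [w Hw].
           exists w; rewrite Hw; discriminate.
        (* The fuel also bounds the range of the search, so it has to exceed [y]. *)
        -- exists (S y + max w0 w1); apply Hs; split; [lia |]; split.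
           ++ apply (proj1 (Hf' y) w0); [lia | assumption].
           ++ intros i Hi; specialize (H1 i Hi).
              destruct (Ef w1 (i :: v)) as [|[|z]] eqn:Ez; simpl in H1; try lia.
              exists z; apply (proj1 (Hf' i) w1); [lia | assumption].
      * intros [w Hw]; apply Hs in Hw as (_ & H0 & Hpos); apply ev_mu.
        -- apply Hf'; exists w; assumption.
        -- intros i Hi; destruct (Hpos i Hi) as [z Hz]; exists z; apply Hf'; exists w; assumption.
Qed.

Lemma fueled_exists p k : exists E, fueled p k E.
Proof.
  revert k; induction p as [| | i | f gs IHf IHgs | f g IHf IHg | f IHf] using rf_nested_ind;
    intros k.
  - exists (fun _ _ => 1); split; [apply Comp_const |]; intros v Hv; split; [auto |].
    intros y; split; [intros H; inversion H; exists 0; reflexivity |].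
    intros [_ H]; injection H as <-; constructor.
  - destruct k as [|k].
    + exists (fun _ _ => 0); split; [apply Comp_const |]; intros [|] Hv; [| discriminate].
      split; [auto |]; intros y; split; [intros H; inversion H | intros [_ H]; discriminate].
    + exists (fun _ v => S (S (var0 v))); split; [apply Comp_S, Comp_S; exact (Comp_var _ 1) |].
      intros [|a v] Hv; [discriminate |]; split; [auto |].
      intros y; split; [intros H; inversion H; exists 0; reflexivity |].
      intros [_ H]; injection H as <-; constructor.
  - exists (fun _ v => S (nth i v 0)); split.
    + apply Comp_S, (Comp_env _ k _ (fun v => tl v) (Comp_nth k i)), CompEnv_tl, CompEnv_id.
    + intros v Hv; split; [auto |].
      intros y; split; [intros H; inversion H; exists 0; reflexivity |].
      intros [_ H]; injection H as <-; constructor.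
  - destruct (fueled_list gs k IHgs) as (A & Env & HA & HEnv & Hs).
    destruct (IHf (length gs)) as (E & HE & Hf).
    exists (fun w v => if0 (A w v) 0 (E w (Env w v))); split.
    + apply Comp_if0; [assumption | apply Comp_const |].
      apply (Comp_env _ (S (length gs)) _ (fun v => var0 v :: Env (var0 v) (tl v)) HE).
      apply CompEnv_cons; [exact (Comp_var _ 0) | assumption].
    + intros v Hv; destruct (Hs v Hv) as [Hm Hr].
      assert (Hlen : forall w, length (Env w v) = length gs).
      { intros w; destruct HEnv as (ps & <- & Hps).
        specialize (Hps (w :: v)); symmetry; eapply Forall2_length, Hps; simpl; congruence. }
      split.
      * intros w w' y Hw; destruct (A w v) eqn:EA; simpl; [discriminate |].
        destruct (Hm w w' Hw) as [H1 ->]; [congruence |].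
        destruct (A w' v); [contradiction |]; simpl; apply Hf; auto.
      * intros y; split.
        -- intros H; inversion H as [| | | ? ? ? ys ? Hys Hy | | |]; subst.
           apply Hr in Hys as (w1 & H1 & <-).
           apply (Hf _ (Hlen w1)) in Hy as [w2 H2].
           exists (max w1 w2); destruct (Hm w1 (max w1 w2)) as [H3 ->]; [lia | assumption |].
           destruct (A (max w1 w2) v); [contradiction |]; simpl.
           apply (proj1 (Hf _ (Hlen w1)) w2); [lia | assumption].
        -- intros [w Hw]; destruct (A w v) eqn:EA; simpl in Hw; [discriminate |].
           apply ev_comp with (Env w v).
           ++ apply Hr; exists w; split; [congruence | reflexivity].
           ++ apply (Hf _ (Hlen w)); exists w; assumption.
  - destruct k as [|k].
    + exists (fun _ _ => 0); split; [apply Comp_const |]; intros [|] Hv; [| discriminate].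
      split; [auto |]; intros y; split; [intros H; inversion H | intros [_ H]; discriminate].
    + destruct (IHf k) as [Ef Hf]; destruct (IHg (S (S k))) as [Eg Hg].
      eexists; apply fueled_rec; eassumption.
  - destruct (IHf (S k)) as [Ef Hf]; eexists; apply fueled_mu; eassumption.
Qed.

Lemma Sig_c_e A : c_e A -> Sig 1 (fun v => A (var0 v)).
Proof.
  intros [p Hp]; destruct (fueled_exists p 1) as (E & HE & Hs); exists E; split; [assumption |].
  intros v Hv; destruct (Hs v Hv) as [Hm Hr]; split.
  - intros w w' Hw H; destruct (E w v) as [|y] eqn:Ey; [congruence |].
    rewrite (Hm w w' y Hw Ey); discriminate.
  - destruct v as [|a [|]]; try discriminate; simpl; rewrite Hp; split.
    + intros [y Hy]; apply Hr in Hy as [w Hw]; exists w; congruence.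
    + intros [w Hw]; destruct (E w [a]) as [|y] eqn:Ey; [congruence |].
      exists y; apply Hr; exists w; assumption.
Qed.
End Computability.

(** * Coordinate charts *)

Lemma sumR_le n f b : (forall i, (i < n)%nat -> f i <= b) -> sumR n f <= INR n * b.
Proof.
  induction n as [|n IH]; intros H; [simpl; lra |].
  rewrite S_INR; simpl; specialize (H n (Nat.lt_succ_diag_r n)) as Hn.
  assert (sumR n f <= INR n * b) by (apply IH; intros; apply H; lia); lra.
Qed.

Lemma sumR_term n f i : (forall i, 0 <= f i) -> (i < n)%nat -> f i <= sumR n f.
Proof.
  intros Hf; assert (Hpos : forall m, 0 <= sumR m f).
  { induction m as [|m IH]; simpl; [lra | specialize (Hf m); lra]. }
  induction n as [|n IH]; intros Hi; [lia |]; simpl.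
  destruct (Nat.eq_dec i n) as [-> |].
  - specialize (Hpos n); lra.
  - assert (f i <= sumR n f) by (apply IH; lia); specialize (Hf n); lra.
Qed.

Lemma dist_n_le n v w t : 0 <= t -> (forall i, (i < n)%nat -> Rabs (v i - w i) <= t) ->
  dist_n n v w <= INR n * t.
Proof.
  intros Ht H; unfold dist_n.
  assert (Hn : 0 <= INR n) by apply pos_INR.
  rewrite <- (sqrt_pow2 (INR n * t)) by (apply Rmult_le_pos; assumption).
  apply sqrt_le_1_alt; eapply Rle_trans; [apply (sumR_le n _ (t ^ 2)) |].
  - intros i Hi; rewrite <- (pow2_abs (v i - w i)); apply pow_incr.
    split; [apply Rabs_pos | auto].
  (* The sum of squares is at most [n] times [t ^ 2]; since [n] is a natural number this is at most
     the square of [n * t]. *)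
  - assert (INR n <= INR n ^ 2).
    { destruct n as [|n]; [simpl; lra |].
      assert (1 <= INR (S n)) by (apply (le_INR 1); lia); nra. }
    rewrite Rpow_mult_distr; apply Rmult_le_compat_r; [apply pow2_ge_0 | assumption].
Qed.

Lemma coordinate_le_dist_n n v w i : (i < n)%nat -> Rabs (v i - w i) <= dist_n n v w.
Proof.
  intros Hi; unfold dist_n; rewrite <- (sqrt_pow2 (Rabs (v i - w i))) by apply Rabs_pos.
  apply sqrt_le_1_alt; rewrite pow2_abs.
  apply (sumR_term n (fun i => (v i - w i) ^ 2)); [intros; apply pow2_ge_0 | assumption].
Qed.

Section Chart.
Context {X : Type} (d : X -> X -> R).
Hypothesis metric_d : is_metric d.

Definition in_box (N : X -> Prop) (n : nat) (h : nat -> X -> R) (a b : nat -> R) (y : X) : Prop :=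
  N y /\ forall i, (i < n)%nat -> a i <= h i y <= b i.

(* [h] are coordinates on [N] centred at [x], with inverse [G]; they are scaled so that the
   cube [-1, 1]^n stays away from the relative boundary of [N] in [M]. *)
Definition local_chart (M : X -> Prop) (x : X) (n : nat) (N : X -> Prop)
  (h : nat -> X -> R) (G : (nat -> R) -> X) : Prop :=
  (forall y, N y -> M y) /\ N x /\ (forall i, (i < n)%nat -> h i x = 0) /\
  (exists r, 0 < r /\ forall y z, in_box N n h (fun _ => -1) (fun _ => 1) y ->
    M z -> d y z < r -> N z) /\
  (forall i y eps, (i < n)%nat -> N y -> 0 < eps ->
    exists r, 0 < r /\ forall z, N z -> d y z < r -> Rabs (h i z - h i y) < eps) /\
  (forall y eps, N y -> 0 < eps -> exists r, 0 < r /\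
    forall u, (forall i, (i < n)%nat -> Rabs (u i - h i y) < r) -> d y (G u) < eps) /\
  (forall u, N (G u)) /\ (forall u i, (i < n)%nat -> h i (G u) = u i) /\
  (forall z, N z -> G (fun i => h i z) = z).

Lemma local_chart_exists M x n N : nbhd_in d M N x -> homeomorphic_Rn d N n ->
  exists h G, local_chart M x n N h G.
Proof.
  intros (HNM & Hx & r0 & Hr0 & Hball) (f & g & Hf & Hg & Hgf & Hfg & Cf & Cg).
  destruct (Cg (f x) (Hf x Hx) (r0 / 2)) as (r1 & Hr1 & Hnear); [lra |].
  rewrite (Hgf x Hx) in Hnear.
  assert (Hn : 0 <= INR n) by apply pos_INR.
  (* The scale makes the unit cube fit into the ball of radius [r1] around [f x], as
     [INR n * s < r1]; adding 1 covers the case [n = 0]. *)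
  set (s := r1 / (INR n + 1)).
  assert (Hs : 0 < s) by (apply Rdiv_lt_0_compat; lra).
  assert (Hns : INR n * s < r1).
  { replace r1 with ((INR n + 1) * s) by (unfold s; field; lra); lra. }
  set (h := fun i y => (f y i - f x i) / s).
  (* Coordinates from [n] on are set to 0, as membership in [Rn n] demands. *)
  set (point := fun (u : nat -> R) i => if lt_dec i n then f x i + s * u i else 0).
  assert (Hpoint : forall u, Rn n (point u)).
  { intros u i Hi; unfold point; destruct (lt_dec i n); [lia | reflexivity]. }
  assert (Hh : forall u i, (i < n)%nat -> h i (g (point u)) = u i).
  { intros u i Hi; unfold h; rewrite Hfg by auto; unfold point.
    destruct (lt_dec i n); [field; lra | contradiction]. }
  assert (Hdiff : forall y i u, (i < n)%nat -> Rabs (f y i - point u i) = s * Rabs (u i - h i y)).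
  { intros y i u Hi; unfold point; destruct (lt_dec i n); [| contradiction].
    rewrite <- (Rabs_pos_eq s) at 2 by lra; rewrite <- Rabs_mult, <- Rabs_Ropp.
    f_equal; unfold h; field; lra. }
  exists h, (fun u => g (point u)).
  split; [assumption | split; [assumption |]].
  split; [intros i _; unfold h; rewrite Rminus_diag; unfold Rdiv; ring |].
  split; [| split; [| split; [| split; [| split]]]].
  (* The unit cube stays within [r0 / 2] of [x], so points of [M] within [r0 / 2] of it lie in the
     ball of radius [r0], hence in [N]. *)
  - exists (r0 / 2); split; [lra |]; intros y z (Hy & Hbox) Hz Hyz.
    assert (d x y < r0 / 2).
    { rewrite <- (Hgf y Hy); apply Hnear; [auto |].
      eapply Rle_lt_trans; [apply (dist_n_le n _ _ s) | assumption]; [lra |].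
      intros i Hi; specialize (Hbox i Hi); unfold h in Hbox.
      assert (Rabs ((f y i - f x i) / s) <= 1) as Habs by (apply Rabs_le; lra).
      rewrite Rabs_minus_sym; replace (f y i - f x i) with (s * ((f y i - f x i) / s)) by (field; lra).
      rewrite Rabs_mult, (Rabs_pos_eq s) by lra; nra. }
    apply Hball; [assumption |]; pose proof (d_triangle d metric_d x y z); lra.
  - intros i y eps Hi Hy Heps.
    destruct (Cf y Hy (s * eps)) as (r & Hr & Hc); [apply Rmult_lt_0_compat; assumption |].
    exists r; split; [assumption |]; intros z Hz Hyz; specialize (Hc z Hz Hyz).
    pose proof (coordinate_le_dist_n n (f y) (f z) i Hi) as Hco.
    unfold h; replace ((f z i - f x i) / s - (f y i - f x i) / s)
      with (- ((f y i - f z i) / s)) by (field; lra).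
    rewrite Rabs_Ropp; unfold Rdiv; rewrite Rabs_mult, (Rabs_pos_eq (/ s))
      by (apply Rlt_le, Rinv_0_lt_compat; assumption).
    apply (Rmult_lt_reg_r s); [assumption |].
    rewrite Rmult_assoc, Rinv_l by lra; lra.
  - intros y eps Hy Heps.
    destruct (Cg (f y) (Hf y Hy) eps Heps) as (r & Hr & Hc); rewrite (Hgf y Hy) in Hc.
    set (t := r / (s * (INR n + 1))).
    assert (Ht : 0 < t) by (apply Rdiv_lt_0_compat; [| apply Rmult_lt_0_compat]; lra).
    exists t; split; [assumption |]; intros u Hu; apply Hc; [auto |].
    apply Rle_lt_trans with (INR n * (s * t)).
    + apply dist_n_le; [apply Rmult_le_pos; lra |]; intros i Hi; rewrite Hdiff by assumption.
      apply Rmult_le_compat_l; [lra | apply Rlt_le, Hu, Hi].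
    + replace r with ((INR n + 1) * (s * t)) by (unfold t; field; lra).
      assert (0 < s * t) by (apply Rmult_lt_0_compat; assumption); lra.
  - auto.
  - exact Hh.
  - intros z Hz; transitivity (g (f z)); [f_equal | apply Hgf, Hz].
    apply functional_extensionality; intros i; unfold point, h.
    destruct (lt_dec i n); [field; lra | symmetry; apply Hf; [assumption | lia]].
Qed.

Section Boxes.
Variables (M : X -> Prop) (x : X) (n : nat) (N : X -> Prop)
  (h : nat -> X -> R) (G : (nat -> R) -> X).
Hypothesis chart : local_chart M x n N h G.

Lemma box_in_M a b y : in_box N n h a b y -> M y.
Proof. intros [Hy _]; apply chart; assumption. Qed.

(** A point of [N] off the box violates a coordinate bound, and by continuity so do its neighbours
    in [N]; a point of [M] outside [N] is kept away by the margin in [local_chart]. *)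
Lemma closed_box a b : (forall i, (i < n)%nat -> -1 <= a i /\ b i <= 1) ->
  closed_in d M (in_box N n h a b).
Proof.
  intros Hab; pose proof chart as (_ & _ & _ & (r & Hr & HN) & Ch & _).
  split; [apply box_in_M |].
  intros y Hy Hnot; destruct (classic (N y)) as [HNy | HNy].
  - assert (Hi : exists i, (i < n)%nat /\ ~ a i <= h i y <= b i).
    { apply NNPP; intros H; apply Hnot; split; [assumption |].
      intros i Hi; apply NNPP; intros Hc; apply H; exists i; auto. }
    destruct Hi as (i & Hi & Hout).
    assert (Heps : exists eps, 0 < eps /\ (h i y + eps <= a i \/ b i + eps <= h i y)).
    { destruct (Rlt_le_dec (h i y) (a i)); [exists (a i - h i y); lra |].
      destruct (Rlt_le_dec (b i) (h i y)); [exists (h i y - b i); lra | tauto]. }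
    destruct Heps as (eps & Heps & Hfar).
    destruct (Ch i y eps Hi HNy Heps) as (t & Ht & Hc); exists t; split; [assumption |].
    intros z Hz [HNz Hbox]; specialize (Hc z HNz Hz); specialize (Hbox i Hi).
    apply Rabs_def2 in Hc; lra.
  - exists r; split; [assumption |]; intros z Hz [HNz Hbox]; apply HNy, (HN z); [| assumption |].
    + split; [assumption |]; intros i Hi; specialize (Hab i Hi); specialize (Hbox i Hi); lra.
    + rewrite (d_sym d metric_d); assumption.
Qed.

(** Cutting at [c] only lowers the [i]-th upper bound, so the result is again a box. *)
Lemma closed_box_below a b i c : (forall j, (j < n)%nat -> -1 <= a j /\ b j <= 1) ->
  (i < n)%nat -> closed_in d M (fun y => in_box N n h a b y /\ h i y <= c).
Proof.
  intros Hab Hi.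
  apply (closed_in_ext d M (in_box N n h a
    (fun j => if Nat.eq_dec j i then Rmin (b j) c else b j))).
  - intros y; split.
    + intros [Hy Hbox]; split; [split; [assumption |] |].
      * intros j Hj; specialize (Hbox j Hj); destruct (Nat.eq_dec j i); [| assumption].
        pose proof (Rmin_l (b j) c); lra.
      * specialize (Hbox i Hi); destruct (Nat.eq_dec i i); [| congruence].
        pose proof (Rmin_r (b i) c); lra.
    + intros [[Hy Hbox] Hc]; split; [assumption |]; intros j Hj; specialize (Hbox j Hj).
      destruct (Nat.eq_dec j i) as [-> |]; [| assumption].
      split; [lra | apply Rmin_glb; lra].
  - apply closed_box; intros j Hj; specialize (Hab j Hj).
    destruct (Nat.eq_dec j i); [pose proof (Rmin_l (b j) c) |]; lra.
Qed.

Lemma closed_box_above a b i c : (forall j, (j < n)%nat -> -1 <= a j /\ b j <= 1) ->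
  (i < n)%nat -> closed_in d M (fun y => in_box N n h a b y /\ c <= h i y).
Proof.
  intros Hab Hi.
  apply (closed_in_ext d M (in_box N n h
    (fun j => if Nat.eq_dec j i then Rmax (a j) c else a j) b)).
  - intros y; split.
    + intros [Hy Hbox]; split; [split; [assumption |] |].
      * intros j Hj; specialize (Hbox j Hj); destruct (Nat.eq_dec j i); [| assumption].
        pose proof (Rmax_l (a j) c); lra.
      * specialize (Hbox i Hi); destruct (Nat.eq_dec i i); [| congruence].
        pose proof (Rmax_r (a i) c); lra.
    + intros [[Hy Hbox] Hc]; split; [assumption |]; intros j Hj; specialize (Hbox j Hj).
      destruct (Nat.eq_dec j i) as [-> |]; [| assumption].
      split; [apply Rmax_lub |]; lra.
  - apply closed_box; intros j Hj; specialize (Hab j Hj).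
    destruct (Nat.eq_dec j i); [pose proof (Rmax_l (a j) c) |]; lra.
Qed.

Definition open_cube (r : R) (y : X) : Prop :=
  N y /\ forall i, (i < n)%nat -> Rabs (h i y) < r.

Lemma open_cube_center r : 0 < r -> open_cube r x.
Proof.
  intros Hr; pose proof chart as (_ & Hx & H0 & _); split; [assumption |].
  intros i Hi; rewrite H0, Rabs_R0 by assumption; assumption.
Qed.

(** The open cube is relatively open in [M]: the margin of the chart puts nearby points of [M] into
    [N], where the coordinates are continuous. *)
Lemma closed_outside_cube r : r <= 1 -> closed_in d M (fun y => M y /\ ~ open_cube r y).
Proof.
  intros Hr1; pose proof chart as (_ & _ & _ & (r0 & Hr0 & HN) & Ch & _).
  split; [tauto |]; intros y Hy Hnot.
  assert (Ho : open_cube r y) by (apply NNPP; tauto); destruct Ho as [HNy Hlt].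
  destruct (uniform_radius_lt n (fun i t => forall z, N z -> d y z < t -> Rabs (h i z) < r))
    as (t & Ht & Hc).
  - intros i t t' Ht H z Hz Hd; apply H; [assumption | lra].
  - intros i Hi; destruct (Ch i y (r - Rabs (h i y)) Hi HNy) as (t & Ht & Hc).
    + specialize (Hlt i Hi); lra.
    + exists t; split; [assumption |]; intros z Hz Hd; specialize (Hc z Hz Hd).
      pose proof (Rabs_triang (h i z - h i y) (h i y)) as Htri.
      replace (h i z - h i y + h i y) with (h i z) in Htri by ring; lra.
  - exists (Rmin r0 t); split; [apply Rmin_glb_lt; assumption |].
    intros z Hz [HMz Hnz]; apply Hnz.
    pose proof (Rmin_l r0 t); pose proof (Rmin_r r0 t).
    assert (HNz : N z).
    { apply (HN y); [| assumption | lra]; split; [assumption |].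
      intros i Hi; specialize (Hlt i Hi); apply Rabs_def2 in Hlt; lra. }
    split; [assumption |]; intros i Hi; apply Hc; [assumption | assumption | lra].
Qed.

End Boxes.
End Chart.

(** * Certified balls *)

Lemma filter_exists {A : Type} (P : A -> Prop) (l : list A) :
  exists l', forall a, In a l' <-> In a l /\ P a.
Proof.
  exists (filter (fun a => if excluded_middle_informative (P a) then true else false) l).
  intros a; rewrite filter_In; destruct (excluded_middle_informative (P a)); intuition congruence.
Qed.

Lemma Rabs_qval s a b : Rabs (qval s a b) = INR a / INR (S b).
Proof.
  unfold qval, Rdiv; rewrite !Rabs_mult, pow_1_abs, Rmult_1_l.
  rewrite (Rabs_pos_eq (INR a)) by apply pos_INR.
  rewrite Rabs_pos_eq; [reflexivity |].
  apply Rlt_le, Rinv_0_lt_compat, lt_0_INR; lia.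
Qed.

Lemma pow2_gt0 m : 0 < 2 ^ m.
Proof. apply pow_lt; lra. Qed.

Lemma exists_small_pow eps : 0 < eps -> exists m, / 2 ^ m < eps.
Proof.
  intros He; destruct (pow_lt_1_zero (/ 2)) with (y := eps) as [m Hm].
  - rewrite Rabs_pos_eq; lra.
  - assumption.
  - exists m; specialize (Hm m (le_n m)).
    rewrite Rabs_pos_eq in Hm by (apply Rlt_le, pow_lt; lra).
    rewrite <- pow_inv; assumption.
Qed.

(** Clearing denominators turns the comparison of reals into one of natural numbers, which is
    decidable by computable functions. *)
Lemma fraction_sum_lt (a b a1 b1 a2 b2 m : nat) :
  INR a1 / INR (S b1) + INR a2 / INR (S b2) + / 2 ^ m < INR a / INR (S b) <->
  (a1 * S b * S b2 * 2 ^ m + a2 * S b * S b1 * 2 ^ m + S b * S b1 * S b2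
    < a * S b1 * S b2 * 2 ^ m)%nat.
Proof.
  assert (HB : forall k, 0 < INR (S k)) by (intros; apply lt_0_INR; lia).
  pose proof (HB b) as H; pose proof (HB b1) as H1; pose proof (HB b2) as H2.
  pose proof (pow2_gt0 m) as Hm.
  assert (Hiff : (INR a1 * INR (S b) * INR (S b2) * 2 ^ m + INR a2 * INR (S b) * INR (S b1) * 2 ^ m
      + INR (S b) * INR (S b1) * INR (S b2) < INR a * INR (S b1) * INR (S b2) * 2 ^ m)
    <-> (a1 * S b * S b2 * 2 ^ m + a2 * S b * S b1 * 2 ^ m + S b * S b1 * S b2
      < a * S b1 * S b2 * 2 ^ m)%nat).
  { replace (2 ^ m) with (INR (2 ^ m)) by (rewrite pow_INR; reflexivity).
    rewrite <- !mult_INR, <- !plus_INR; split; [apply INR_lt | apply lt_INR]. }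
  rewrite <- Hiff; clear Hiff.
  set (D := INR (S b) * INR (S b1) * INR (S b2) * 2 ^ m).
  assert (HD : 0 < D) by (unfold D; repeat apply Rmult_lt_0_compat; assumption).
  assert (E1 : INR a1 * INR (S b) * INR (S b2) * 2 ^ m + INR a2 * INR (S b) * INR (S b1) * 2 ^ m
      + INR (S b) * INR (S b1) * INR (S b2)
    = D * (INR a1 / INR (S b1) + INR a2 / INR (S b2) + / 2 ^ m))
    by (unfold D; field; repeat split; lra).
  assert (E2 : INR a * INR (S b1) * INR (S b2) * 2 ^ m = D * (INR a / INR (S b)))
    by (unfold D; field; lra).
  rewrite E1, E2; split.
  - apply Rmult_lt_compat_l; assumption.
  - apply Rmult_lt_reg_l; assumption.
Qed.

Lemma fraction_lt_pow (a b m : nat) : INR a / INR (S b) < / 2 ^ m <-> (a * 2 ^ m < S b)%nat.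
Proof.
  pose proof (pow2_gt0 m) as Hm; assert (H : 0 < INR (S b)) by (apply lt_0_INR; lia).
  assert (Hiff : (a * 2 ^ m < S b)%nat <-> INR a * 2 ^ m < INR (S b)).
  { replace (2 ^ m) with (INR (2 ^ m)) by (rewrite pow_INR; reflexivity).
    rewrite <- mult_INR; split; [apply lt_INR | apply INR_lt]. }
  rewrite Hiff.
  assert (HD : 0 < INR (S b) * 2 ^ m) by (apply Rmult_lt_0_compat; assumption).
  assert (E1 : INR (S b) * 2 ^ m * (INR a / INR (S b)) = INR a * 2 ^ m) by (field; lra).
  assert (E2 : INR (S b) * 2 ^ m * / 2 ^ m = INR (S b)) by (field; lra).
  split; intros Hlt.
  - apply (Rmult_lt_compat_l _ _ _ HD) in Hlt; rewrite E1, E2 in Hlt; assumption.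
  - apply (Rmult_lt_reg_l _ _ _ HD); rewrite E1, E2; assumption.
Qed.

Ltac comp := cbv beta; repeat first
  [ exact (Comp_var _ 0) | exact (Comp_var _ 1) | exact (Comp_var _ 2) | exact (Comp_var _ 3)
  | exact (Comp_var _ 4) | exact (Comp_var _ 5) | exact (Comp_var _ 6)
  | match goal with
    | H : computable1 ?f |- Comp _ (fun v => ?f (@?F v)) => apply (Comp_app1 _ f F H)
    | H : computable2 ?f |- Comp _ (fun v => ?f (@?F v) (@?G v)) => apply (Comp_app2 _ f F G H)
    | H : computable3 ?f |- Comp _ (fun v => ?f (@?F v) (@?G v) (@?K v)) =>
        apply (Comp_app3 _ f F G K H)
    end
  | apply Comp_const | apply Comp_S | apply Comp_add | apply Comp_mul | apply Comp_pow2 ].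

(** * Formal disjointness of rational balls *)

Section LocalComputability.
Context {X : Type} (d : X -> X -> R) (alpha : nat -> X) (q : nat -> R)
  (tau1 tau2 : nat -> nat) (sigma : nat -> nat -> nat) (eta : nat -> nat).
Hypothesis space : computable_metric_space d alpha.
Hypothesis enums : fixed_enumerations q tau1 tau2 sigma eta.

Let metric_d : is_metric d := proj1 space.
Let computable_tau1 : computable1 tau1. Proof. apply enums. Qed.
Let computable_tau2 : computable1 tau2. Proof. apply enums. Qed.
Let computable_sigma : computable2 sigma. Proof. apply enums. Qed.
Let computable_eta : computable1 eta. Proof. apply enums. Qed.

Notation center := (lam alpha tau1).
Notation radius := (rho q tau2).
Notation I := (Iball d alpha q tau1 tau2).
Notation code := (in_code sigma eta).

(* The finite set coded by [j] with the first entry of the code dropped: unlike [in_code],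
   this also represents the empty set. *)
Definition tail_code (j t : nat) : Prop := exists k, (k < eta j)%nat /\ sigma j (S k) = t.

(** Formal disjointness: it implies disjointness of the balls and, as a strict inequality between
    computable reals, is semi-decidable. *)
Definition apart (s t : nat) : Prop := radius s + radius t < d (center s) (center t).

Definition all_apart (u v : nat) : Prop :=
  forall s, tail_code u s -> forall t, tail_code v t -> apart s t.

Lemma radius_computable : exists a b, computable1 a /\ computable1 b /\
  forall t, radius t = INR (a (tau2 t)) / INR (S (b (tau2 t))).
Proof.
  pose proof enums as ((s & a & b & _ & Ha & Hb & Hq) & Hpos & _).
  exists a, b; split; [assumption | split; [assumption |]]; intros t.
  rewrite <- (Rabs_qval (s (tau2 t))), <- Hq; unfold rho.
  rewrite Rabs_pos_eq; [reflexivity | apply Rlt_le, Hpos].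
Qed.

Lemma Sig_apart : Sig 2 (fun v => apart (var0 v) (var1 v)).
Proof.
  destruct radius_computable as (a1 & b1 & Ha1 & Hb1 & Hr).
  pose proof space as (_ & _ & s & a & b & _ & Ha & Hb & Hd).
  apply (Sig_ext 2 _ (fun v => exists m,
    let i := tau1 (var0 v) in let j := tau1 (var1 v) in
    let i' := tau2 (var0 v) in let j' := tau2 (var1 v) in
    a1 i' * S (b i j m) * S (b1 j') * 2 ^ m + a1 j' * S (b i j m) * S (b1 i') * 2 ^ m
      + S (b i j m) * S (b1 i') * S (b1 j') < a i j m * S (b1 i') * S (b1 j') * 2 ^ m)%nat).
  - intros v _; cbv zeta; unfold apart; rewrite !Hr.
    set (s0 := var0 v); set (t0 := var1 v).
    assert (Happrox : forall m, Rabs (d (center s0) (center t0) -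
      INR (a (tau1 s0) (tau1 t0) m) / INR (S (b (tau1 s0) (tau1 t0) m))) < / 2 ^ m).
    { intros m; rewrite <- (Rabs_qval (s (tau1 s0) (tau1 t0) m)).
      eapply Rle_lt_trans; [| apply Hd].
      rewrite <- (Rabs_pos_eq (d (center s0) (center t0))) at 1 by apply metric_d.
      apply Rabs_triang_inv2. }
    split.
    + intros Hlt.
      (* A precision below half the gap leaves room for the error of the approximate distance and
         for the margin [/ 2 ^ m]. *)
      destruct (exists_small_pow ((d (center s0) (center t0) -
        (INR (a1 (tau2 s0)) / INR (S (b1 (tau2 s0))) + INR (a1 (tau2 t0)) / INR (S (b1 (tau2 t0)))))
        / 2)) as [m Hm]; [lra |].
      exists m; apply fraction_sum_lt; specialize (Happrox m); apply Rabs_def2 in Happrox; lra.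
    + intros [m Hm]; apply fraction_sum_lt in Hm.
      specialize (Happrox m); apply Rabs_def2 in Happrox; lra.
  - apply Sig_ex; cbv beta zeta; apply Sig_lt; comp.
Qed.

Lemma Sig_radius_lt :
  Sig 2 (fun v => radius (var1 v) < / 2 ^ var0 v).
Proof.
  destruct radius_computable as (a & b & Ha & Hb & Hr).
  apply (Sig_ext 2 _ (fun v =>
    a (tau2 (var1 v)) * 2 ^ var0 v < S (b (tau2 (var1 v))))%nat).
  - intros v _; rewrite Hr; apply fraction_lt_pow.
  - apply Sig_lt; comp.
Qed.

Lemma Sig_tail_code k F G :
  Comp k F -> Comp k G -> Sig k (fun v => tail_code (F v) (G v)).
Proof.
  intros HF HG; apply (Sig_app2 k tail_code F G); [| assumption | assumption].
  apply Sig_ex; cbv beta; apply Sig_and; [apply Sig_lt | apply Sig_eq]; comp.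
Qed.

Lemma Sig_code k F G : Comp k F -> Comp k G -> Sig k (fun v => code (F v) (G v)).
Proof.
  intros HF HG; apply (Sig_app2 k code F G); [| assumption | assumption].
  apply (Sig_ext 2 _ (fun v => exists i,
    (i < S (eta (var0 v)))%nat /\ sigma (var0 v) i = var1 v)%nat).
  - intros v _; split; intros (i & Hi & E); exists i; split; (lia || assumption).
  - apply Sig_ex; cbv beta; apply Sig_and; [apply Sig_lt | apply Sig_eq]; comp.
Qed.

Lemma Sig_all_tail_code k F (P : nat -> list nat -> Prop) :
  Sig (S k) (fun v => P (var0 v) (tl v)) -> Comp k F ->
  Sig k (fun v => forall t, tail_code (F v) t -> P t v).
Proof.
  intros HP HF.
  apply (Sig_ext k _ (fun v => forall i, (i < eta (F v))%nat -> P (sigma (F v) (S i)) v)).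
  - intros v _; split.
    + intros H i Hi; apply H; exists i; auto.
    + intros H t (i & Hi & <-); auto.
  - assert (HF' : Comp (S k) (fun v => F (tl v)))
      by (apply (Comp_env _ k F _ HF), CompEnv_tl, CompEnv_id).
    apply Sig_all; [| comp; assumption].
    apply (Sig_env _ (S k) _ (fun v => sigma (F (tl v)) (S (var0 v)) :: tl v) HP).
    apply CompEnv_cons; [comp; assumption | apply CompEnv_tl, CompEnv_id].
Qed.

Lemma Sig_all_code k F (P : nat -> list nat -> Prop) :
  Sig (S k) (fun v => P (var0 v) (tl v)) -> Comp k F ->
  Sig k (fun v => forall t, code (F v) t -> P t v).
Proof.
  intros HP HF.
  apply (Sig_ext k _ (fun v => forall i, (i < S (eta (F v)))%nat -> P (sigma (F v) i) v)).
  - intros v _; split.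
    + intros H i Hi; apply H; exists i; split; [lia | reflexivity].
    + intros H t (i & Hi & <-); apply H; lia.
  - assert (HF' : Comp (S k) (fun v => F (tl v)))
      by (apply (Comp_env _ k F _ HF), CompEnv_tl, CompEnv_id).
    apply Sig_all; [| comp; assumption].
    apply (Sig_env _ (S k) _ (fun v => sigma (F (tl v)) (var0 v) :: tl v) HP).
    apply CompEnv_cons; [comp; assumption | apply CompEnv_tl, CompEnv_id].
Qed.

Lemma Sig_all_apart k F G :
  Comp k F -> Comp k G -> Sig k (fun v => all_apart (F v) (G v)).
Proof.
  intros HF HG; apply (Sig_app2 k all_apart F G); [| assumption | assumption].
  apply (Sig_all_tail_code 2 (fun v => var0 v)
    (fun s v => forall t, tail_code (var1 v) t -> apart s t)); [| comp].
  apply (Sig_all_tail_code 3 (fun v => var2 v) (fun t v => apart (var0 v) t));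
    [| comp].
  apply (Sig_app2 _ apart); [exact Sig_apart | comp | comp].
Qed.

(** * Certificates and their semi-decidability *)

Variable M : X -> Prop.
Hypothesis semicomputable_M : semicomputable_compact d alpha q tau1 tau2 sigma eta M.
Let compact_M : compact d M := proj1 semicomputable_M.

Definition covering (j : nat) : Prop := forall y, M y -> Jset d alpha q tau1 tau2 sigma eta j y.

(** [c] and [c'] are read as finite sequences whose [i]-th entries are themselves codes, through
    [tail_code], of finite families of balls. *)
Definition families_apart (n c c' : nat) : Prop :=
  forall i, (i < n)%nat -> all_apart (sigma c i) (sigma c' i).

Definition labelled (n w j e c c' : nat) : Prop := forall t, code j t ->
  t = e \/ tail_code w t \/
  exists i, (i < n)%nat /\ (tail_code (sigma c i) t \/ tail_code (sigma c' i) t).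

(* A semi-decidable certificate that the ball [e] meets [M]: were it not so, the families
   [c] and [c'] would give [n] pairs of disjoint open sets covering the [n]-cube bounded by
   the faces inside [p] and [p']. *)
Definition certified (n w p p' k e : nat) : Prop :=
  radius e < / 2 ^ k /\ exists j c c', covering j /\ labelled n w j e c c' /\
    families_apart n c c' /\ families_apart n c p' /\ families_apart n c' p.

(** [m] is the candidate for the approximation at precision [k]. The first clause lets its points
    reach every point of [M] not covered by [w']; the second attaches a certified ball to each
    listed centre. *)
Definition approximates (n w p p' w' m k : nat) : Prop :=
  (exists j, covering j /\ forall t, code j t ->
    tail_code w' t \/ certified n w p p' k t /\ code m (tau1 t)) /\
  forall s, code m s -> exists t, certified n w p p' k t /\ tau1 t = s.

Lemma Sig_covering k F : Comp k F -> Sig k (fun v => covering (F v)).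
Proof.
  intros HF; apply (Sig_app1 k covering); [| assumption].
  apply (Sig_c_e covering), semicomputable_M.
Qed.

Lemma Sig_families_apart k n F G :
  Comp k F -> Comp k G -> Sig k (fun v => families_apart n (F v) (G v)).
Proof.
  intros HF HG; apply (Sig_app2 k (families_apart n) F G); [| assumption | assumption].
  apply (Sig_all 2 (fun _ => n) (fun i v =>
    all_apart (sigma (var0 v) i) (sigma (var1 v) i))); [| comp].
  apply Sig_all_apart; comp.
Qed.

Lemma Sig_labelled k n w F1 F2 F3 F4 : Comp k F1 -> Comp k F2 -> Comp k F3 -> Comp k F4 ->
  Sig k (fun v => labelled n w (F1 v) (F2 v) (F3 v) (F4 v)).
Proof.
  intros H1 H2 H3 H4.
  apply (Sig_env k 4 (fun v => labelled n w (var0 v) (var1 v) (var2 v)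
    (var3 v))%nat (fun v => [F1 v; F2 v; F3 v; F4 v]));
    [| repeat apply CompEnv_cons; auto using CompEnv_nil].
  apply (Sig_all_code 4 (fun v => var0 v) (fun t v =>
    t = var1 v \/ tail_code w t \/ exists i, i < n /\
      (tail_code (sigma (var2 v) i) t \/
       tail_code (sigma (var3 v) i) t))%nat); [| comp].
  apply Sig_or; [apply Sig_eq; comp |].
  apply Sig_or; [apply Sig_tail_code; comp |].
  apply Sig_ex; cbv beta; apply Sig_and; [apply Sig_lt; comp |].
  apply Sig_or; apply Sig_tail_code; comp.
Qed.

Lemma Sig_certified k n w p p' F G :
  Comp k F -> Comp k G -> Sig k (fun v => certified n w p p' (F v) (G v)).
Proof.
  intros HF HG; apply (Sig_app2 k (certified n w p p') F G); [| assumption | assumption].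
  apply Sig_and; [exact Sig_radius_lt |].
  do 3 (apply Sig_ex; cbv beta).
  apply Sig_and; [apply Sig_covering; comp |].
  apply Sig_and; [apply Sig_labelled; comp |].
  repeat apply Sig_and; apply Sig_families_apart; comp.
Qed.

Lemma Sig_approximates n w p p' w' :
  Sig 2 (fun v => approximates n w p p' w' (var0 v) (var1 v)).
Proof.
  apply Sig_and.
  - apply Sig_ex; cbv beta; apply Sig_and; [apply Sig_covering; comp |].
    apply (Sig_all_code 3 (fun v => var0 v) (fun t v => tail_code w' t \/
      certified n w p p' (var2 v) t /\ code (var1 v) (tau1 t))); [| comp].
    apply Sig_or; [apply Sig_tail_code; comp |].
    apply Sig_and; [apply Sig_certified; comp | apply Sig_code; comp].
  - apply (Sig_all_code 2 (fun v => var0 v) (fun s v => exists t,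
      certified n w p p' (var1 v) t /\ tau1 t = s)); [| comp].
    apply Sig_ex; cbv beta; apply Sig_and; [apply Sig_certified; comp | apply Sig_eq; comp].
Qed.

(** * Covers by small rational balls, and their codes *)

Lemma small_ball y eps : 0 < eps -> exists t, radius t < eps /\ I t y.
Proof.
  intros Heps; pose proof space as (_ & Hdense & _).
  pose proof enums as (_ & _ & Hq & _ & _ & Htau & _).
  destruct (archimed_cor1 eps Heps) as (m & Hm & Hm0).
  destruct m as [|m]; [lia |].
  assert (Hr : 0 < / INR (S m)) by (apply Rinv_0_lt_compat, lt_0_INR; lia).
  destruct (Hq (/ INR (S m)) Hr) as [k Hk].
  { exists 0%nat, 1%nat, m; unfold qval, Rdiv; simpl pow; rewrite INR_1; ring. }
  destruct (Hdense y _ Hr) as [i Hi]; destruct (Htau i k) as (t & Ht1 & Ht2).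
  exists t; unfold Iball, ball, lam, rho; rewrite Ht1, Ht2, Hk.
  split; [assumption |]; rewrite (d_sym d metric_d); assumption.
Qed.

Lemma cover_by_small_balls K eps : compact d K -> 0 < eps -> exists l,
  (forall t, In t l -> radius t < eps /\ exists y, K y /\ I t y) /\
  (forall y, K y -> exists t, In t l /\ I t y).
Proof.
  intros HK Heps.
  destruct (HK {t | radius t < eps /\ exists y, K y /\ I t y} (fun t => I (proj1_sig t)))
    as [l Hl].
  - intros t; apply is_open_ball, metric_d.
  - intros y Hy; destruct (small_ball y eps Heps) as (t & Ht & Hty).
    assert (Hp : radius t < eps /\ exists y, K y /\ I t y) by eauto.
    exists (exist _ t Hp); assumption.
  - exists (map (@proj1_sig _ _) l); split.
    + intros t Ht; apply in_map_iff in Ht as ([s Hs] & <- & _); assumption.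
    + intros y Hy; destruct (Hl y Hy) as (t & Ht & Hty).
      exists (proj1_sig t); split; [apply in_map; assumption | assumption].
Qed.

Lemma cover_missing K L : closed_in d M K -> closed_in d M L ->
  (forall y, K y -> ~ L y) -> exists l,
  (forall y, K y -> exists t, In t l /\ I t y) /\
  (forall t y, In t l -> I t y -> ~ L y).
Proof.
  intros HK HL Hdis.
  assert (HcK : compact d K) by (apply (compact_closed_in d metric_d M); assumption).
  destruct (compact_separated d metric_d M K L HcK) as (r & Hr & Hsep); auto.
  { apply HK. }
  (* Two points of a ball of radius below [r / 2] are less than [r] apart, so such a ball cannot
     meet both [K] and [L]. *)
  destruct (cover_by_small_balls K (r / 2) HcK) as (l & Hsmall & Hcov); [lra |].
  exists l; split; [assumption |]; intros t y Ht Hy HLy.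
  destruct (Hsmall t Ht) as (Hlt & a & Ha & HIa); specialize (Hsep a y Ha HLy).
  unfold Iball, ball in Hy, HIa; pose proof (d_triangle d metric_d a (center t) y).
  rewrite (d_sym d metric_d a (center t)) in *; unfold rho in *; lra.
Qed.

Lemma apart_disjoint s t y : apart s t -> I s y -> ~ I t y.
Proof.
  unfold apart, Iball, ball; intros Hst Hs Ht.
  pose proof (d_triangle d metric_d (center s) y (center t)) as H.
  rewrite (d_sym d metric_d y (center t)) in H; unfold rho in *; lra.
Qed.

(** The factor 4 pays for the passage from [a] and [b] to the centres and for the two radii. *)
Lemma apart_of_separated eps s t a b :
  radius s < eps -> radius t < eps -> I s a -> I t b -> 4 * eps <= d a b -> apart s t.
Proof.
  unfold apart, Iball, ball; intros Hs Ht Ha Hb Hab.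
  pose proof (d_triangle d metric_d a (center s) b).
  pose proof (d_triangle d metric_d (center s) (center t) b).
  rewrite (d_sym d metric_d a (center s)) in *; unfold rho in *; lra.
Qed.

Lemma code_exists l : l <> [] -> exists j, forall t, code j t <-> In t l.
Proof.
  intros Hl; pose proof enums as (_ & _ & _ & _ & _ & _ & _ & _ & Hseq).
  destruct (Hseq l Hl) as (j & Hj & Hs); exists j; intros t; split.
  - intros (k & Hk & <-); rewrite Hs by lia; apply nth_In; lia.
  - intros Ht; destruct (In_nth l t 0%nat Ht) as (k & Hk & <-).
    exists k; split; [lia | apply Hs; assumption].
Qed.

Lemma tail_code_exists l : exists j, forall t, tail_code j t <-> In t l.
Proof.
  pose proof enums as (_ & _ & _ & _ & _ & _ & _ & _ & Hseq).
  destruct (Hseq (0%nat :: l)) as (j & Hj & Hs); [discriminate |].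
  simpl in Hj; exists j; intros t; split.
  - intros (k & Hk & <-); rewrite Hs by (simpl; lia); cbn [nth]; apply nth_In; lia.
  - intros Ht; destruct (In_nth l t 0%nat Ht) as (k & Hk & <-).
    exists k; split; [lia | apply (Hs (S k)); simpl; lia].
Qed.

Lemma code_family n (P : nat -> list nat -> Prop) :
  (forall i, (i < n)%nat -> exists l, P i l) ->
  exists c, forall i, (i < n)%nat ->
    exists l, P i l /\ forall t, tail_code (sigma c i) t <-> In t l.
Proof.
  intros HP; pose proof enums as (_ & _ & _ & _ & _ & _ & _ & _ & Hseq).
  assert (Hcs : exists cs, length cs = n /\ forall i, (i < n)%nat ->
    exists l, P i l /\ forall t, tail_code (nth i cs 0%nat) t <-> In t l).
  { induction n as [|n IH]; [exists []; split; [reflexivity | lia] |].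
    destruct IH as (cs & Hlen & Hcs); [auto with arith |].
    destruct (HP n) as [l Hl]; [lia |]; destruct (tail_code_exists l) as [j Hj].
    exists (cs ++ [j]); split; [rewrite length_app; simpl; lia |].
    intros i Hi; destruct (Nat.eq_dec i n) as [-> |].
    - exists l; split; [assumption |]; rewrite <- Hlen, nth_middle; assumption.
    - rewrite app_nth1 by lia; apply Hcs; lia. }
  destruct Hcs as (cs & Hlen & Hcs).
  (* The extra entry keeps the sequence nonempty when [n = 0]. *)
  destruct (Hseq (cs ++ [0%nat])) as (c & _ & Hc); [destruct cs; discriminate |].
  exists c; intros i Hi; rewrite Hc by (rewrite length_app; simpl; lia).
  rewrite app_nth1 by lia; auto.
Qed.

(** * Boxes of a chart, their faces and fine covers *)

Variables (x : X) (n : nat) (N : X -> Prop) (h : nat -> X -> R) (G : (nat -> R) -> X).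
Hypothesis chart : local_chart d M x n N h G.

Notation cube r := (in_box N n h (fun _ => - r%R) (fun _ => r%R)).

(** Inside the cube the inequality forces equality; in this form faces are instances of
    [closed_box_below] and [closed_box_above]. *)
Definition lower_face (i : nat) (y : X) : Prop := cube (3 / 4) y /\ h i y <= - (3 / 4).
Definition upper_face (i : nat) (y : X) : Prop := cube (3 / 4) y /\ 3 / 4 <= h i y.
Definition below (c : nat -> R) (i : nat) (y : X) : Prop := cube 1 y /\ h i y <= c i.
Definition above (c : nat -> R) (i : nat) (y : X) : Prop := cube 1 y /\ c i <= h i y.

Lemma closed_lower_face i : (i < n)%nat -> closed_in d M (lower_face i).
Proof. apply (closed_box_below d metric_d M x n N h G chart); intros; lra. Qed.

Lemma closed_upper_face i : (i < n)%nat -> closed_in d M (upper_face i).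
Proof. apply (closed_box_above d metric_d M x n N h G chart); intros; lra. Qed.

Lemma closed_below c i : (i < n)%nat -> closed_in d M (below c i).
Proof. apply (closed_box_below d metric_d M x n N h G chart); intros; lra. Qed.

Lemma closed_above c i : (i < n)%nat -> closed_in d M (above c i).
Proof. apply (closed_box_above d metric_d M x n N h G chart); intros; lra. Qed.

Lemma closed_cube r : r <= 1 -> closed_in d M (cube r).
Proof. intros Hr; apply (closed_box d metric_d M x n N h G chart); intros; lra. Qed.

Lemma families_separated (K L : nat -> X -> Prop) :
  (forall i, (i < n)%nat -> closed_in d M (K i)) ->
  (forall i, (i < n)%nat -> closed_in d M (L i)) ->
  (forall i y, (i < n)%nat -> K i y -> ~ L i y) ->
  exists eps, 0 < eps /\ forall i, (i < n)%nat -> forall a b, K i a -> L i b -> 4 * eps <= d a b.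
Proof.
  intros HK HL Hdis.
  apply (uniform_radius_lt n (fun i eps => forall a b, K i a -> L i b -> 4 * eps <= d a b)).
  - intros i r r' Hr H a b Ha Hb; specialize (H a b Ha Hb); lra.
  - intros i Hi.
    destruct (compact_separated d metric_d M (K i) (L i)) as (r & Hr & Hsep).
    + apply (compact_closed_in d metric_d M); auto.
    + apply (HK i Hi).
    + apply (HL i Hi).
    + intros y; apply (Hdis i y Hi).
    + exists (r / 4); split; [lra |]; intros a b Ha Hb; specialize (Hsep a b Ha Hb); lra.
Qed.

Definition fine_cover (eps : R) (K : X -> Prop) (j : nat) : Prop :=
  (forall t, tail_code j t -> radius t < eps /\ exists y, K y /\ I t y) /\
  (forall y, K y -> exists t, tail_code j t /\ I t y).

Lemma fine_cover_family eps (K : nat -> X -> Prop) : 0 < eps ->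
  (forall i, (i < n)%nat -> closed_in d M (K i)) ->
  exists c, forall i, (i < n)%nat -> fine_cover eps (K i) (sigma c i).
Proof.
  intros Heps HK.
  destruct (code_family n (fun i l =>
    (forall t, In t l -> radius t < eps /\ exists y, K i y /\ I t y) /\
    (forall y, K i y -> exists t, In t l /\ I t y))) as [c Hc].
  - intros i Hi; apply cover_by_small_balls; [| assumption].
    apply (compact_closed_in d metric_d M); auto.
  - exists c; intros i Hi; destruct (Hc i Hi) as (l & [Hs Hcov] & Hl); split.
    + intros t Ht; apply Hs, Hl, Ht.
    + intros y Hy; destruct (Hcov y Hy) as (t & Ht & HI); exists t; rewrite Hl; auto.
Qed.

Lemma fine_covers_apart (K L : nat -> X -> Prop) eps eps1 eps2 u v :
  eps1 <= eps -> eps2 <= eps ->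
  (forall i, (i < n)%nat -> forall a b, K i a -> L i b -> 4 * eps <= d a b) ->
  (forall i, (i < n)%nat -> fine_cover eps1 (K i) (sigma u i)) ->
  (forall i, (i < n)%nat -> fine_cover eps2 (L i) (sigma v i)) ->
  families_apart n u v.
Proof.
  intros H1 H2 Hsep HK HL i Hi s Hs t Ht.
  destruct (proj1 (HK i Hi) s Hs) as (Hrs & a & Ha & HIa).
  destruct (proj1 (HL i Hi) t Ht) as (Hrt & b & Hb & HIb).
  apply (apart_of_separated eps s t a b); [lra | lra | assumption | assumption |].
  apply (Hsep i Hi); assumption.
Qed.

Notation outside r := (fun y => M y /\ ~ open_cube n N h r%R y).

(** The point [y0] guarantees a nonempty list, as required by [code_exists]. *)
Lemma covering_code (P : nat -> Prop) (y0 : X) : M y0 ->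
  (forall y, M y -> exists t, P t /\ I t y) ->
  exists l, l <> [] /\ (forall t, In t l -> P t) /\ (forall y, M y -> exists t, In t l /\ I t y).
Proof.
  intros Hy0 Hcov.
  destruct (compact_M {t | P t} (fun t => I (proj1_sig t))) as [l Hl].
  - intros t; apply is_open_ball, metric_d.
  - intros y Hy; destruct (Hcov y Hy) as (t & Ht & HI); exists (exist _ t Ht); assumption.
  - exists (map (@proj1_sig _ _) l); split; [| split].
    + destruct (Hl y0 Hy0) as (t & Ht & _); destruct l; [contradiction | discriminate].
    + intros t Ht; apply in_map_iff in Ht as ([s Hs] & <- & _); assumption.
    + intros y Hy; destruct (Hl y Hy) as (t & Ht & HI).
      exists (proj1_sig t); split; [apply in_map |]; assumption.
Qed.

Lemma cube_center r : 0 <= r -> cube r x.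
Proof.
  intros Hr; pose proof chart as (_ & Hx & H0 & _); split; [assumption |].
  intros i Hi; rewrite H0 by assumption; lra.
Qed.

(** * Correctness and existence of certificates *)

Section Constants.
(** The numbers [w], [p], [p'] and [w'] code the fixed open sets. They enter the search as
    constants, so their mere existence suffices. *)
Variables (w p p' w' : nat) (eps0 : R).
Hypothesis w_covers : forall y, outside 1 y -> exists t, tail_code w t /\ I t y.
Hypothesis w_misses : forall t y, tail_code w t -> I t y -> ~ cube (3 / 4) y.
Hypothesis w'_covers : forall y, outside (1 / 2) y -> exists t, tail_code w' t /\ I t y.
Hypothesis w'_misses : forall t y, tail_code w' t -> I t y -> ~ cube (1 / 4) y.
Hypothesis eps0_pos : 0 < eps0.
Hypothesis p_covers : forall i, (i < n)%nat -> fine_cover eps0 (lower_face i) (sigma p i).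
Hypothesis p'_covers : forall i, (i < n)%nat -> fine_cover eps0 (upper_face i) (sigma p' i).
Hypothesis lower_separated : forall i, (i < n)%nat -> forall a b,
  above (fun _ => - (1 / 2)) i a -> lower_face i b -> 4 * eps0 <= d a b.
Hypothesis upper_separated : forall i, (i < n)%nat -> forall a b,
  below (fun _ => 1 / 2) i a -> upper_face i b -> 4 * eps0 <= d a b.

Lemma certified_meets k e : certified n w p p' k e -> exists y, M y /\ I e y.
Proof.
  intros (_ & j & c & c' & Hcov & Hlab & Hcc & Hcp & Hcp').
  pose proof chart as (_ & _ & _ & _ & Ch & CG & HGN & HhG & HGh).
  set (U := fun i y => exists t, tail_code (sigma c i) t /\ I t y).
  set (V := fun i y => exists t, tail_code (sigma c' i) t /\ I t y).
  assert (Hopen : forall c i, is_open d (fun y => exists t, tail_code (sigma c i) t /\ I t y)).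
  { intros c0 i y (t & Ht & HIy).
    destruct (is_open_ball d metric_d (center t) (radius t) y HIy) as (r & Hr & Hball).
    exists r; split; [assumption |]; intros z Hz; exists t; split; [assumption |].
    apply Hball, Hz. }
  destruct (partitions_meet d metric_d (cube (3 / 4)) n h G (- (3 / 4)) (3 / 4))
    with (U := U) (V := V) as (y & Hy & Hout).
  - lra.
  - apply (compact_closed_in d metric_d M); [assumption |]; apply closed_cube; lra.
  - intros i y eps Hi [Hy _] Heps; destruct (Ch i y eps Hi Hy Heps) as (r & Hr & Hc).
    exists r; split; [assumption |]; intros z [Hz _]; auto.
  - intros y eps [Hy _] Heps; destruct (CG y eps Hy Heps) as (r & Hr & Hc).
    exists r; split; [assumption |]; intros u _; apply Hc.
  - intros u Hu; split; [apply HGN |]; intros i Hi; rewrite HhG by assumption; auto.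
  - intros u i _; apply HhG.
  - apply Hopen.
  - apply Hopen.
  - intros i y Hi _ (s & Hs & HIs) (t & Ht & HIt).
    apply (apart_disjoint s t y); auto; apply (Hcc i Hi); assumption.
  (* The balls of [p] cover the lower face and those of [c'] are apart from them, so [V i] misses
     that face; the next case is symmetric. *)
  - intros i y Hi Hy Hh (s & Hs & HIs).
    destruct (proj2 (p_covers i Hi) y) as (t & Ht & HIt); [split; [assumption | lra] |].
    apply (apart_disjoint s t y); auto; apply (Hcp' i Hi); assumption.
  - intros i y Hi Hy Hh (s & Hs & HIs).
    destruct (proj2 (p'_covers i Hi) y) as (t & Ht & HIt); [split; [assumption | lra] |].
    apply (apart_disjoint s t y); auto; apply (Hcp i Hi); assumption.
  - assert (HMy : M y) by (apply chart, Hy).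
    exists y; split; [assumption |].
    destruct (Hcov y HMy) as (t & Ht & HIt).
    destruct (Hlab t Ht) as [<- | [Hw | (i & Hi & [Hc | Hc])]]; [assumption | | |]; exfalso.
    + apply (w_misses t y Hw HIt Hy).
    + apply (proj1 (Hout i Hi)); exists t; auto.
    + apply (proj2 (Hout i Hi)); exists t; auto.
Qed.

Lemma certified_dense k y0 : open_cube n N h (1 / 2) y0 ->
  exists t, certified n w p p' k t /\ I t y0.
Proof.
  intros [HNy0 Hy0]; pose proof chart as (HNM & _ & _ & _ & _ & CG & _ & _ & HGh).
  destruct (small_ball y0 (/ 2 ^ k)) as (e & Hrad & He); [apply Rinv_0_lt_compat, pow2_gt0 |].
  exists e; split; [| assumption]; split; [assumption |].
  destruct (is_open_ball d metric_d (center e) (radius e) y0 He) as (r & Hr & Hball).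
  (* [s] is such that coordinates within [s] of those of [y0] force a point into the ball [e]. *)
  destruct (CG y0 r HNy0 Hr) as (s & Hs & Hnear).
  set (K := below (fun i => h i y0 - s)); set (L := above (fun i => h i y0 + s)).
  destruct (families_separated K L) as (eps & Heps & Hsep).
  { intros; apply closed_below; assumption. }
  { intros; apply closed_above; assumption. }
  { intros i y Hi [_ HK] [_ HL]; lra. }
  (* [eps] separates [K i] from [L i], while [eps0] separates both from the faces; the covers have
     to respect both bounds. *)
  assert (Hmin : 0 < Rmin eps eps0) by (apply Rmin_glb_lt; assumption).
  pose proof (Rmin_l eps eps0) as Hl; pose proof (Rmin_r eps eps0) as Hr0.
  destruct (fine_cover_family (Rmin eps eps0) K) as [c Hc]; [assumption | |].
  { intros; apply closed_below; assumption. }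
  destruct (fine_cover_family (Rmin eps eps0) L) as [c' Hc']; [assumption | |].
  { intros; apply closed_above; assumption. }
  destruct (covering_code (fun t => t = e \/ tail_code w t \/ exists i, (i < n)%nat /\
    (tail_code (sigma c i) t \/ tail_code (sigma c' i) t)) y0) as (l & Hlne & Hlab & Hcov).
  { auto. }
  (* Outside the open unit cube [w] covers. Inside, either all coordinates are close to those of
     [y0] and [e] covers, or one differs by at least [s] and puts [y] into [K i] or [L i]. *)
  { intros y HMy; destruct (classic (open_cube n N h 1 y)) as [Hy | Hy].
    - assert (Hcube : cube 1 y).
      { split; [apply Hy |]; intros i Hi; apply Hy in Hi; apply Rabs_def2 in Hi; lra. }
      destruct (classic (forall i, (i < n)%nat -> Rabs (h i y - h i y0) < s)) as [Hclose | Hfar].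
      + exists e; split; [auto |]; apply Hball.
        rewrite <- (HGh y) by apply Hy; apply Hnear, Hclose.
      + apply not_all_ex_not in Hfar as [i Hi]; apply imply_to_and in Hi as [Hi Hfar].
        destruct (Rle_lt_dec (h i y) (h i y0 - s)) as [Hle | Hlt].
        * destruct (proj2 (Hc i Hi) y) as (t & Ht & HIt); [split; assumption |].
          exists t; split; [| assumption]; right; right; exists i; auto.
        * destruct (Rle_lt_dec (h i y0 + s) (h i y)) as [Hle | Hlt'];
            [| contradiction Hfar; apply Rabs_def1; lra].
          destruct (proj2 (Hc' i Hi) y) as (t & Ht & HIt); [split; assumption |].
          exists t; split; [| assumption]; right; right; exists i; auto.
    - destruct (w_covers y) as (t & Ht & HIt); [auto |]; exists t; auto. }
  destruct (code_exists l Hlne) as [j Hj].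
  exists j, c, c'; split; [| split; [| split; [| split]]].
  - intros y Hy; destruct (Hcov y Hy) as (t & Ht & HIt); exists t; rewrite Hj; auto.
  - intros t Ht; apply Hlab, Hj, Ht.
  - apply (fine_covers_apart K L eps (Rmin eps eps0) (Rmin eps eps0)); assumption.
  (* As [h i y0 < 1 / 2], the set [K i] lies in the part of the cube with [h i] at most [1 / 2],
     which has distance at least [4 * eps0] from the upper face. *)
  - apply (fine_covers_apart K upper_face eps0 (Rmin eps eps0) eps0); try assumption; [lra |].
    intros i Hi a b [Ha Hle] Hb; apply (upper_separated i Hi); [split; [assumption |] | assumption].
    specialize (Hy0 i Hi); apply Rabs_def2 in Hy0; lra.
  - apply (fine_covers_apart L lower_face eps0 (Rmin eps eps0) eps0); try assumption; [lra |].
    intros i Hi a b [Ha Hle] Hb; apply (lower_separated i Hi); [split; [assumption |] | assumption].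
    specialize (Hy0 i Hi); apply Rabs_def2 in Hy0; lra.
Qed.

Lemma approximation_exists k : exists m, approximates n w p p' w' m k.
Proof.
  assert (Hx : M x) by apply chart, chart.
  destruct (covering_code (fun t => tail_code w' t \/ certified n w p p' k t) x Hx)
    as (l & Hlne & Hlab & Hcov).
  { intros y Hy; destruct (classic (open_cube n N h (1 / 2) y)) as [Ho | Ho].
    - destruct (certified_dense k y Ho) as (t & Ht & HI); exists t; auto.
    - destruct (w'_covers y) as (t & Ht & HI); [auto |]; exists t; auto. }
  (* Only the certified balls of the cover contribute their centres to [m]. *)
  destruct (filter_exists (certified n w p p' k) l) as [l' Hl'].
  destruct (code_exists (map tau1 l')) as [m Hm].
  (* The ball covering [x] cannot belong to [w'], because [x] lies in the smallest cube; so some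
     centre is listed. *)
  { destruct (Hcov x Hx) as (t & Ht & HI).
    assert (Hin : In t l').
    { apply Hl'; split; [assumption |]; destruct (Hlab t Ht) as [Hw |]; [exfalso | assumption].
      apply (w'_misses t x Hw HI), cube_center; lra. }
    destruct l'; [contradiction | discriminate]. }
  destruct (code_exists l Hlne) as [j Hj].
  exists m; split.
  - exists j; split.
    + intros y Hy; destruct (Hcov y Hy) as (t & Ht & HI); exists t; rewrite Hj; auto.
    + intros t Ht; apply Hj in Ht; destruct (Hlab t Ht) as [| Hc]; [auto |].
      right; split; [assumption |]; apply Hm, in_map, Hl'; auto.
  - intros s Hs; apply Hm, in_map_iff in Hs as (t & <- & Ht); apply Hl' in Ht.
    exists t; tauto.
Qed.

Lemma cube_computable_up_to : computable_up_to d alpha sigma eta (cube (1 / 4)) M.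
Proof.
  destruct (Sig_choice (fun m k => approximates n w p p' w' m k)) as (f & Hf & Happ).
  - exact (Sig_approximates n w p p' w').
  - exact approximation_exists.
  - exists f; split; [assumption |]; intros k.
    destruct (Happ k) as [(j & Hcov & Hlab) Hcert]; split.
    (* A covering ball through a point of the smallest cube is not in [w'], hence is certified, and
       its centre is listed by [f k] and closer than [/ 2 ^ k]. *)
    + intros a Ha; assert (HMa : M a) by (apply chart, Ha).
      destruct (Hcov a HMa) as (t & Ht & HI).
      destruct (Hlab t Ht) as [Hw | [[Hrad _] Hm]]; [exfalso; apply (w'_misses t a Hw HI Ha) |].
      exists (center t); split; [exists (tau1 t); auto |].
      rewrite (d_sym d metric_d); unfold Iball, ball in HI; unfold rho in *; lra.
    (* A listed centre belongs to a certified ball, which contains a point of [M] and has radius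
       below [/ 2 ^ k]. *)
    + intros a (s & Hs & ->); destruct (Hcert s Hs) as (t & Ht & <-).
      destruct (certified_meets k t Ht) as (y & HMy & HI); exists y; split; [assumption |].
      destruct Ht as [Hrad _]; unfold Iball, ball, lam, rho in *; lra.
Qed.
End Constants.

Lemma cube_nbhd r : 0 < r <= 1 -> nbhd_in d M (cube r) x.
Proof.
  intros Hr; split; [| split].
  - intros y Hy; apply chart, Hy.
  - apply cube_center; lra.
  - destruct (closed_outside_cube d M x n N h G chart r) as [_ Hopen]; [lra |].
    destruct (Hopen x) as (t & Ht & Hball).
    + apply chart, chart.
    + intros [_ Hn]; apply Hn, (open_cube_center d M x n N h G chart); lra.
    + exists t; split; [assumption |]; intros y Hy Hd.
      assert (Ho : open_cube n N h r y) by (apply NNPP; intros Hn; apply (Hball y Hd); auto).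
      split; [apply Ho |]; intros i Hi; apply Ho in Hi; apply Rabs_def2 in Hi; lra.
Qed.

Lemma outside_cover r s : 0 <= r < s -> s <= 1 -> exists w,
  (forall y, outside s y -> exists t, tail_code w t /\ I t y) /\
  (forall t y, tail_code w t -> I t y -> ~ cube r y).
Proof.
  intros Hrs Hs.
  destruct (cover_missing (outside s) (cube r)) as (l & Hcov & Hmiss).
  - apply (closed_outside_cube d M x n N h G chart); assumption.
  - apply closed_cube; lra.
  - intros y [_ Hout] [HN Hbox]; apply Hout; split; [assumption |]; intros i Hi.
    specialize (Hbox i Hi); apply Rabs_def1; lra.
  - destruct (tail_code_exists l) as [w Hw]; exists w; split.
    + intros y Hy; destruct (Hcov y Hy) as (t & Ht & HI); exists t; rewrite Hw; auto.
    + intros t y Ht; apply Hmiss, Hw, Ht.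
Qed.

(** Four nested cubes are used: [1 / 4] is approximated, [1 / 2] is where certificates exist,
    [3 / 4] is the cube with partitions, and 1 bounds the chart. Compactness turns the gaps between
    them into the constants. *)
Lemma locally_computable : exists N', nbhd_in d M N' x /\ computable_up_to d alpha sigma eta N' M.
Proof.
  exists (cube (1 / 4)); split; [apply cube_nbhd; lra |].
  destruct (outside_cover (3 / 4) 1) as (w & Hw1 & Hw2); [lra | lra |].
  destruct (outside_cover (1 / 4) (1 / 2)) as (w' & Hw'1 & Hw'2); [lra | lra |].
  destruct (families_separated (above (fun _ => - (1 / 2))) lower_face) as (e1 & He1 & Hsep1).
  { intros; apply closed_above; assumption. }
  { apply closed_lower_face. }
  { intros i y Hi [_ Ha] [_ Hb]; lra. }
  destruct (families_separated (below (fun _ => 1 / 2)) upper_face) as (e2 & He2 & Hsep2).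
  { intros; apply closed_below; assumption. }
  { apply closed_upper_face. }
  { intros i y Hi [_ Ha] [_ Hb]; lra. }
  assert (He : 0 < Rmin e1 e2) by (apply Rmin_glb_lt; assumption).
  pose proof (Rmin_l e1 e2); pose proof (Rmin_r e1 e2).
  destruct (fine_cover_family (Rmin e1 e2) lower_face He closed_lower_face) as [p Hp].
  destruct (fine_cover_family (Rmin e1 e2) upper_face He closed_upper_face) as [p' Hp'].
  apply (cube_computable_up_to w p p' w' (Rmin e1 e2)); auto.
  - intros i Hi a b Ha Hb; specialize (Hsep1 i Hi a b Ha Hb); lra.
  - intros i Hi a b Ha Hb; specialize (Hsep2 i Hi a b Ha Hb); lra.
Qed.
End LocalComputability.

Theorem theorem5p6 (X : Type) (d : X -> X -> R) (alpha : nat -> X)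
  (q : nat -> R) (tau1 tau2 : nat -> nat) (sigma : nat -> nat -> nat) (eta : nat -> nat)
  (S : X -> Prop) (x : X) :
  computable_metric_space d alpha ->
  fixed_enumerations q tau1 tau2 sigma eta ->
  semicomputable_compact d alpha q tau1 tau2 sigma eta S ->
  S x ->
  (exists (n : nat) (N : X -> Prop), nbhd_in d S N x /\ homeomorphic_Rn d N n) ->
  exists N : X -> Prop, nbhd_in d S N x /\ computable_up_to d alpha sigma eta N S.
Proof.
  intros space enums HS _ (n & N & Hnbhd & Hhomeo).
  destruct (local_chart_exists d (proj1 space) S x n N Hnbhd Hhomeo) as (h & G & chart).
  exact (locally_computable d alpha q tau1 tau2 sigma eta space enums S HS x n N h G chart).
Qed.
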